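(* For every $n\in\mathbb{N}$: $\mathrm{Det}_{\mathfrak{D}_{n+1}}\equiv_W \mathrm{C}_{\{0,1\}^\mathbb{N}}^{[n]}$ and $\mathrm{Win}_{\mathfrak{D}_{n+1}}\equiv_W\mathrm{LPO}^{[n]}$.
   Context: Represented spaces $(X,\delta_X)$, $\delta_X:\subseteq\mathbb{N}^\mathbb{N}\to X$ partial surjection; realizers of $f:\subseteq X\rightrightarrows Y$ are $F$ with $\delta_Y(F(p))\in f(\delta_X(p))$ for $\delta_X(p)\in\mathrm{dom}(f)$. $f\leq_W g$ iff there are computable $K,H$ with $p\mapsto K(\langle p,G(H(p))\rangle)$ realizing $f$ for every realizer $G$ of $g$; $\equiv_W$ induced equivalence. $\lim:\subseteq\mathbb{N}^\mathbb{N}\to\mathbb{N}^\mathbb{N}$, $\lim(p)(n)=\lim_{i\to\infty}p(\langle n,i\rangle)$. Jump of a space: $(X,\delta_X)'=(X,\delta_X\circ\lim)$, $X^{(0)}=X$, $X^{(n+1)}=(X^{(n)})'$; for $f:X\rightrightarrows Y$, $f^{[n]}:X^{(n)}\rightrightarrows Y$ is the same map with input space replaced by its $n$-th jump. $\mathrm{LPO}:\{0,1\}^\mathbb{N}\to\{0,1\}$ outputs $1$ iff $p=0^\mathbb{N}$. $\mathrm{C}_{\{0,1\}^\mathbb{N}}$ maps a nonempty closed subset of $\{0,1\}^\mathbb{N}$ (named by an enumeration of cylinders $w\{0,1\}^\mathbb{N}$ covering its complement) to any of its elements. $\mathfrak{D}_m$ consists of sets $D\subseteq\{0,1\}^\mathbb{N}$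 for which there are open $U_0,\ldots,U_{m-1}$ with $x\in D\iff\min\{\beta\mid x\in U_\beta\}\not\equiv m\pmod 2$ ($\min\emptyset=m$), named by names of $U_0,\ldots,U_{m-1}$ (open sets named by enumerations of words whose cylinders form the set). Games: win/lose games with players 1,2, choices $\{0,1\}$, turn function $d:\{0,1\}^*\to\{1,2\}$ (lookup table), winning set for player 1, complement won by player 2; winning strategies as usual; strategy profiles are functions $\{0,1\}^*\to\{0,1\}$. $\mathrm{Det}_\Gamma$: input such a game with player-1 winning set given by a $\Gamma$-name; output any strategy profile in which one of the strategies is winning. $\mathrm{Win}_\Gamma$: same input, output which player has a winning strategy. *)

(* Defs.v *)
From Stdlib Require Import Arith List Cantor.
Import ListNotations.

Definition B := nat -> nat.

Definition npair (n i : nat) : nat := Cantor.to_nat (n, i).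

Definition bjoin (p q : B) : B :=
  fun n => if Nat.even n then p (Nat.div2 n) else q (Nat.div2 n).

Inductive code : Type :=
| cZero | cSucc | cId | cFst | cSnd | cOracle
| cPair (f g : code)
| cComp (f g : code)
| cPrec (f g : code)
| cMu (f : code).

Inductive eval (p : B) : code -> nat -> nat -> Prop :=
| eZero x : eval p cZero x 0
| eSucc x : eval p cSucc x (S x)
| eId x : eval p cId x x
| eFst x : eval p cFst x (fst (Cantor.of_nat x))
| eSnd x : eval p cSnd x (snd (Cantor.of_nat x))
| eOracle x : eval p cOracle x (p x)
| ePair f g x a b : eval p f x a -> eval p g x b -> eval p (cPair f g) x (npair a b)
| eComp f g x y z : eval p g x y -> eval p f y z -> eval p (cComp f g) x z
| ePrec0 f g x y : eval p f x y -> eval p (cPrec f g) (npair x 0) y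
| ePrecS f g x n y z : eval p (cPrec f g) (npair x n) y ->
    eval p g (npair x (npair n y)) z -> eval p (cPrec f g) (npair x (S n)) z
| eMu f x n : eval p f (npair x n) 0 ->
    (forall m, m < n -> exists v, v <> 0 /\ eval p f (npair x m) v) ->
    eval p (cMu f) x n.

Definition computes (e : code) (p q : B) : Prop := forall n, eval p e n (q n).

(** A representation of X: delta p x means "p is a name of x". *)
Definition rep (X : Type) := B -> X -> Prop.

(** A partial realizer G :⊆ B -> B is given by its domain D and values G. *)
Definition realizes {X Y : Type} (dX : rep X) (dY : rep Y) (f : X -> Y -> Prop)
  (D : B -> Prop) (G : B -> B) : Prop :=
  forall p x, dX p x -> (exists y, f x y) -> D p /\ exists y, dY (G p) y /\ f x y.

(** Weihrauch reducibility f <=_W g; dom f = { x | exists y, f x y }. *)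
Definition wle {X Y X' Y' : Type} (dX : rep X) (dY : rep Y) (f : X -> Y -> Prop)
  (dX' : rep X') (dY' : rep Y') (g : X' -> Y' -> Prop) : Prop :=
  exists h k : code,
    forall (D : B -> Prop) (G : B -> B), realizes dX' dY' g D G ->
      forall p x, dX p x -> (exists y, f x y) ->
        exists q, computes h p q /\ D q /\
          exists r, computes k (bjoin p (G q)) r /\
            exists y, dY r y /\ f x y.

Definition wequiv {X Y X' Y' : Type} (dX : rep X) (dY : rep Y) (f : X -> Y -> Prop)
  (dX' : rep X') (dY' : rep Y') (g : X' -> Y' -> Prop) : Prop :=
  wle dX dY f dX' dY' g /\ wle dX' dY' g dX dY f.

Definition islim (p q : B) : Prop :=
  forall n, exists i0, forall i, i0 <= i -> p (npair n i) = q n.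

Definition jump {X : Type} (d : rep X) : rep X :=
  fun p x => exists q, islim p q /\ d q x.

Fixpoint jumpn {X : Type} (n : nat) (d : rep X) : rep X :=
  match n with 0 => d | S m => jump (jumpn m d) end.

Definition Cantor := nat -> bool.

Definition rep_cantor : rep Cantor := fun p x => forall n, p n = Nat.b2n (x n).

Definition rep_bool : rep bool := fun p b => p 0 = Nat.b2n b.

(** Words {0,1}^* coded bijectively by nat:
    0 -> [], 2m+1 -> false :: w(m), 2m+2 -> true :: w(m). *)
Fixpoint word_aux (fuel n : nat) : list bool :=
  match fuel with
  | 0 => []
  | S f => match n with
           | 0 => []
           | S m => Nat.even n :: word_aux f (Nat.div2 m)
           end
  end.
Definition word_of_nat (n : nat) : list bool := word_aux n n.

Definition prefix (x : Cantor) (k : nat) : list bool := map x (seq 0 k).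

Definition in_cyl (w : list bool) (x : Cantor) : Prop := prefix x (length w) = w.

(** Open set named by p: union of cylinders of enumerated words
    (p n = 0: no word; p n = k+1: word number k). *)
Definition open_named (p : B) (x : Cantor) : Prop :=
  exists n k, p n = S k /\ in_cyl (word_of_nat k) x.

Definition rep_closed : rep (Cantor -> Prop) :=
  fun p A => forall x, A x <-> ~ open_named p x.

Definition CC (A : Cantor -> Prop) (x : Cantor) : Prop := A x.

Definition LPO (x : Cantor) (b : bool) : Prop := b = true <-> (forall n, x n = false).

(** D_m: x in D iff min{beta | x in U_beta} (min {} = m) is not = m mod 2.
    The name consists of names of U_0..U_{m-1}: U_beta named by j |-> p <beta,j>. *)
Definition Dm_cond (m : nat) (U : nat -> Cantor -> Prop) (x : Cantor) : Prop :=
  exists beta, beta <= m /\ (beta = m \/ U beta x) /\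
    (forall gamma, gamma < beta -> ~ U gamma x) /\
    Nat.odd beta <> Nat.odd m.

Definition rep_Dm (m : nat) : rep (Cantor -> Prop) :=
  fun p D => forall x, D x <-> Dm_cond m (fun beta => open_named (fun j => p (npair beta j))) x.

Inductive player := P1 | P2.

Definition rep_turn : rep (list bool -> player) :=
  fun p d => forall n, (p n = 1 /\ d (word_of_nat n) = P1) \/ (p n = 2 /\ d (word_of_nat n) = P2).

(** A game: turn function and winning set for player 1. *)
Definition game := ((list bool -> player) * (Cantor -> Prop))%type.

Definition rep_game (dW : rep (Cantor -> Prop)) : rep game :=
  fun p G => rep_turn (fun n => p (2 * n)) (fst G) /\ dW (fun n => p (2 * n + 1)) (snd G).

Definition profile := list bool -> bool.
Definition rep_profile : rep profile := fun p s => forall n, p n = Nat.b2n (s (word_of_nat n)).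

Definition rep_player : rep player :=
  fun p i => (p 0 = 1 /\ i = P1) \/ (p 0 = 2 /\ i = P2).

Definition winning (G : game) (i : player) (s : profile) : Prop :=
  forall x : Cantor,
    (forall k, fst G (prefix x k) = i -> x k = s (prefix x k)) ->
    match i with P1 => snd G x | P2 => ~ snd G x end.

Definition Det (G : game) (s : profile) : Prop := winning G P1 s \/ winning G P2 s.
Definition Win (G : game) (i : player) : Prop := exists s, winning G i s.

(* Main.v *)
(** Upper bounds.  For a difference game given by [U_0, ..., U_n] let the level of a position be
    the least index entered so far.  The player who profits from reaching a level below [beta]
    plays an open game whose target are the positions of lower level at which his opponent does
    not win the game of level [beta - 1]; by compactness winning it is a [Sigma_1] condition
    relative to the winning positions of level [beta - 1], so the winning positions of level
    [n + 1] are [Sigma_1] in an [n]-fold limit of the name of the game.  A profile in which the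
    attacker of the current level never chooses a successor of larger rank, and his opponent
    never one of smaller rank, is winning for the right player, and these profiles form a closed
    set with an [n]-fold limit name.

    Lower bounds.  Given an [n]-fold limit name of an enumeration of cylinders, player 2 plays a
    point [x] bit by bit.  Player 1 wins iff [x] lies in an enumerated cylinder: he commits to an
    item of the enumeration together with a modulus for the outermost limit, player 2 replies
    with a counterexample and a modulus for the next limit, and so on.  The [n + 1] commitments
    correspond to entering [U_n, ..., U_0], the last one being checked against the name. *)

From Stdlib Require Import Arith List Cantor Bool Lia Classical ClassicalEpsilon FunctionalExtensionality.
Require Import Defs.
Import ListNotations.

(** * Pairing and recursion on numbers *)

Definition pi1 (z : nat) : nat := fst (Cantor.of_nat z).
Definition pi2 (z : nat) : nat := snd (Cantor.of_nat z).

Lemma pi1_npair a b : pi1 (npair a b) = a.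
Proof. unfold pi1, npair; now rewrite Cantor.cancel_of_to. Qed.

Lemma pi2_npair a b : pi2 (npair a b) = b.
Proof. unfold pi2, npair; now rewrite Cantor.cancel_of_to. Qed.

Lemma npair_pi z : npair (pi1 z) (pi2 z) = z.
Proof.
  unfold npair, pi1, pi2.
  rewrite <- (Cantor.cancel_to_of z) at 3. f_equal. now destruct (Cantor.of_nat z).
Qed.

Lemma pi_le z : pi1 z + pi2 z <= z.
Proof.
  rewrite <- (npair_pi z) at 3. unfold npair.
  pose proof (Cantor.to_nat_spec (pi1 z) (pi2 z)). nia.
Qed.

Lemma pi1_0 : pi1 0 = 0.
Proof. pose proof (pi_le 0); lia. Qed.

Lemma pi2_0 : pi2 0 = 0.
Proof. pose proof (pi_le 0); lia. Qed.

Lemma npair_ge a b : a + b <= npair a b.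
Proof. pose proof (pi_le (npair a b)). now rewrite pi1_npair, pi2_npair in H. Qed.

#[global] Opaque npair pi1 pi2.

Definition rec (a : nat) (f : nat -> nat -> nat) (n : nat) : nat :=
  nat_rect (fun _ => nat) a f n.

Lemma rec_0 a f : rec a f 0 = a.
Proof. reflexivity. Qed.

Lemma rec_S a f n : rec a f (S n) = f n (rec a f n).
Proof. reflexivity. Qed.

Arguments rec : simpl never.

(** ** Primitive recursive functionals *)

(** These are total, so no reduction below needs unbounded search; totality also makes them
    continuous everywhere, which is why they commute with limits ([PR_islim]). *)
Inductive PR : (B -> nat -> nat) -> Prop :=
| PR_O : PR (fun _ _ => 0)
| PR_succ : PR (fun _ x => S x)
| PR_id : PR (fun _ x => x)
| PR_fst : PR (fun _ x => pi1 x)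
| PR_snd : PR (fun _ x => pi2 x)
| PR_oracle : PR (fun p x => p x)
| PR_npair F G : PR F -> PR G -> PR (fun p x => npair (F p x) (G p x))
| PR_comp F G : PR F -> PR G -> PR (fun p x => F p (G p x))
| PR_prec F G : PR F -> PR G ->
    PR (fun p z => rec (F p (pi1 z)) (fun i r => G p (npair (pi1 z) (npair i r))) (pi2 z)).

Lemma PR_code F : PR F -> exists e, forall p, computes e p (F p).
Proof.
  unfold computes.
  induction 1 as [| | | | | | F G _ [f Hf] _ [g Hg] | F G _ [f Hf] _ [g Hg] | F G _ [f Hf] _ [g Hg]].
  - exists cZero; constructor.
  - exists cSucc; constructor.
  - exists cId; constructor.
  - exists cFst; constructor.
  - exists cSnd; constructor.
  - exists cOracle; constructor.
  - exists (cPair f g); intros; constructor; auto.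
  - exists (cComp f g); intros; econstructor; eauto.
  - exists (cPrec f g); intros p z.
    rewrite <- (npair_pi z) at 1.
    induction (pi2 z) as [|m IH].
    + rewrite rec_0; constructor; auto.
    + rewrite rec_S; econstructor; eauto.
Qed.

Lemma PR_continuous F : PR F -> forall p x, exists N, forall p',
  (forall m, m < N -> p' m = p m) -> F p' x = F p x.
Proof.
  induction 1 as [| | | | | | F G _ IF _ IG | F G _ IF _ IG | F G _ IF _ IG]; intros p x;
    try (exists 0; reflexivity).
  - exists (S x); auto.
  - destruct (IF p x) as [a Ha], (IG p x) as [b Hb]. exists (a + b); intros p' H.
    rewrite Ha, Hb; auto; intros; apply H; lia.
  - destruct (IG p x) as [b Hb], (IF p (G p x)) as [a Ha]. exists (a + b); intros p' H.
    rewrite Hb, Ha; auto; intros; apply H; lia.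
  - induction (pi2 x) as [|m [a Ha]].
    + destruct (IF p (pi1 x)) as [a Ha]. exists a; auto.
    + destruct (IG p (npair (pi1 x) (npair m (rec (F p (pi1 x)) (fun i r => G p (npair (pi1 x) (npair i r))) m)))) as [b Hb].
      exists (a + b); intros p' H. rewrite !rec_S.
      rewrite Ha, Hb; auto; intros; apply H; lia.
Qed.

Definition PR2 (Q : B -> nat -> nat -> nat) : Prop := PR (fun p z => Q p (pi1 z) (pi2 z)).
Definition PRb (F : B -> nat -> bool) : Prop := PR (fun p x => Nat.b2n (F p x)).

Lemma PR_const c : PR (fun _ _ => c).
Proof.
  induction c. apply PR_O. apply (PR_comp _ _ PR_succ IHc).
Qed.

Lemma PR_oracle_app G : PR G -> PR (fun p x => p (G p x)).
Proof. apply (PR_comp _ _ PR_oracle). Qed.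

Lemma PR_S G : PR G -> PR (fun p x => S (G p x)).
Proof. apply (PR_comp _ _ PR_succ). Qed.

Lemma PR_pi1 G : PR G -> PR (fun p x => pi1 (G p x)).
Proof. apply (PR_comp _ _ PR_fst). Qed.

Lemma PR_pi2 G : PR G -> PR (fun p x => pi2 (G p x)).
Proof. apply (PR_comp _ _ PR_snd). Qed.

Lemma PR_ext F G : PR F -> (forall p x, F p x = G p x) -> PR G.
Proof.
  intros H E. replace G with F; auto.
  apply functional_extensionality; intro p; apply functional_extensionality; auto.
Qed.

Lemma PR2_app Q G H : PR2 Q -> PR G -> PR H -> PR (fun p x => Q p (G p x) (H p x)).
Proof.
  intros HQ HG HH. eapply PR_ext. apply (PR_comp _ _ HQ (PR_npair _ _ HG HH)).
  intros; cbn beta. now rewrite pi1_npair, pi2_npair.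
Qed.

Lemma PR_rec A N F : PR A -> PR N ->
  PR (fun p z => F p (pi1 z) (pi1 (pi2 z)) (pi2 (pi2 z))) ->
  PR (fun p x => rec (A p x) (F p x) (N p x)).
Proof.
  intros HA HN HF. eapply PR_ext.
  apply (PR_comp _ _ (PR_prec _ _ HA HF) (PR_npair _ _ PR_id HN)).
  intros p x; cbn beta. rewrite pi1_npair, pi2_npair. f_equal.
  apply functional_extensionality; intro i; apply functional_extensionality; intro r.
  now repeat rewrite ?pi1_npair, ?pi2_npair.
Qed.

(** Oracle substitution is not a constructor of [PR], hence the induction on [T]. The parameter [x]
    admits a family of oracles, which [PR_islim] uses for the successive approximations of a
    limit. *)
Lemma PR_subst2 T Q : PR T -> PR2 Q -> PR2 (fun p x a => T (Q p x) a).
Proof.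
  intros HT HQ.
  induction HT as [| | | | | | F G _ IF _ IG | F G _ IF _ IG | F G _ IF _ IG].
  - apply PR_O.
  - apply PR_S, PR_snd.
  - apply PR_snd.
  - apply PR_pi1, PR_snd.
  - apply PR_pi2, PR_snd.
  - exact HQ.
  - apply PR_npair; assumption.
  - apply (PR2_app _ _ _ IF); [apply PR_fst|apply IG].
  - apply PR_rec.
    + apply (PR2_app _ _ _ IF); [apply PR_fst|apply PR_pi1, PR_snd].
    + apply PR_pi2, PR_snd.
    + apply (PR2_app _ _ _ IG); [apply PR_pi1, PR_fst|].
      apply PR_npair. apply PR_pi1, PR_pi2, PR_fst.
      apply PR_npair. apply PR_pi1, PR_snd. apply PR_pi2, PR_snd.
Qed.

Lemma PR_subst T G : PR T -> PR G -> PR (fun p => T (G p)).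
Proof.
  intros HT HG.
  assert (HQ : PR2 (fun p _ m => G p m)) by exact (PR_comp _ _ HG PR_snd).
  exact (PR2_app _ _ _ (PR_subst2 _ _ HT HQ) (PR_const 0) PR_id).
Qed.

(** At index [i], [T'] runs [T] on the [i]-th approximation. By continuity one output depends on
    finitely many entries, which are all stable from a common index on. *)
Lemma PR_islim T : PR T -> exists T', PR T' /\
  forall p q, islim p q -> islim (T' p) (T q).
Proof.
  intros HT. exists (fun p z => T (fun m => p (npair m (pi2 z))) (pi1 z)). split.
  - assert (HQ : PR2 (fun p i m => p (npair m i))).
    { apply PR_oracle_app, PR_npair; [apply PR_snd|apply PR_fst]. }
    exact (PR2_app _ _ _ (PR_subst2 _ _ HT HQ) PR_snd PR_fst).
  - intros p q L x. destruct (PR_continuous _ HT q x) as [N HN].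
    assert (HL : exists i0, forall i, i0 <= i -> forall m, m < N -> p (npair m i) = q m).
    { clear HN. induction N as [|N [a Ha]].
      - exists 0; lia.
      - destruct (L N) as [b Hb]. exists (a + b); intros i Hi m Hm.
        destruct (Nat.eq_dec m N) as [->|]; [apply Hb|apply Ha]; lia. }
    destruct HL as [i0 Hi]. exists i0; intros i Hle.
    rewrite pi1_npair, pi2_npair. apply HN; auto.
Qed.

(** * Iterated limits *)

Fixpoint limn (n : nat) (p q : B) : Prop :=
  match n with 0 => p = q | S m => exists r, islim p r /\ limn m r q end.

Lemma jumpn_limn X (d : rep X) n p x : jumpn n d p x <-> exists q, limn n p q /\ d q x.
Proof.
  revert p; induction n as [|n IH]; simpl; intros p.
  - split; [eauto|]. now intros (q & -> & H).
  - unfold jump; split.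
    + intros (r & H & K). apply IH in K as (q & K & D). eauto.
    + intros (q & (r & H & K) & D). exists r; split; auto. apply IH; eauto.
Qed.

(** A computable step precedes each limit; [PR_islim] moves the remaining computation in front of
    that limit, so that all [n] limits come last. *)
Lemma PR_limn_iterate F T n : PR F -> PR T -> exists E, PR E /\
  forall q : nat -> B, (forall i, islim (F (q i)) (q (S i))) -> limn n (E (q 0)) (T (q n)).
Proof.
  intros HF HT. induction n as [|n (E & HE & IH)].
  - exists T; split; simpl; auto.
  - destruct (PR_islim _ HE) as (E' & HE' & L).
    exists (fun p => E' (F p)); split.
    + exact (PR_subst _ _ HE' HF).
    + intros q Hq. exists (E (q 1)); split; auto.
      apply (IH (fun i => q (S i))); auto.
Qed.

(** * Closure under arithmetic, Boolean operations and bounded search *)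

Lemma PR_PRb F : PRb F -> PR (fun p x => Nat.b2n (F p x)).
Proof. auto. Qed.

Lemma PR_pred G : PR G -> PR (fun p x => pred (G p x)).
Proof.
  intros H. apply PR_ext with (fun p x => rec 0 (fun i _ => i) (G p x)).
  - apply PR_rec; [apply PR_O|exact H|apply PR_pi1, PR_snd].
  - intros; now destruct (G p x).
Qed.

Lemma PR_add F G : PR F -> PR G -> PR (fun p x => F p x + G p x).
Proof.
  intros HF HG. apply PR_ext with (fun p x => rec (F p x) (fun _ r => S r) (G p x)).
  - apply PR_rec; auto. apply PR_S, PR_pi2, PR_snd.
  - intros. induction (G p x); rewrite ?rec_0, ?rec_S; lia.
Qed.

Lemma PR_sub F G : PR F -> PR G -> PR (fun p x => F p x - G p x).
Proof.
  intros HF HG. apply PR_ext with (fun p x => rec (F p x) (fun _ r => pred r) (G p x)).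
  - apply PR_rec; auto. apply PR_pred, PR_pi2, PR_snd.
  - intros. induction (G p x); rewrite ?rec_0, ?rec_S; lia.
Qed.

Lemma PR_mul F G : PR F -> PR G -> PR (fun p x => F p x * G p x).
Proof.
  intros HF HG. apply PR_ext with (fun p x => rec 0 (fun _ r => r + F p x) (G p x)).
  - apply PR_rec; [apply PR_O|auto|].
    apply PR_add; [apply PR_pi2, PR_snd|apply (PR_comp _ _ HF PR_fst)].
  - intros. induction (G p x); rewrite ?rec_0, ?rec_S; lia.
Qed.

Lemma PR_pow2 G : PR G -> PR (fun p x => 2 ^ G p x).
Proof.
  intros HG. apply PR_ext with (fun p x => rec 1 (fun _ r => 2 * r) (G p x)).
  - apply PR_rec; [apply PR_const|auto|].
    apply PR_mul; [apply PR_const|apply PR_pi2, PR_snd].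
  - intros. induction (G p x); [auto|]. rewrite rec_S, IHn. simpl; lia.
Qed.

Lemma PRb_eq0 G : PR G -> PRb (fun p x => G p x =? 0).
Proof.
  intros HG. eapply PR_ext. apply (PR_sub _ _ (PR_const 1) HG).
  intros; cbn beta. destruct (G p x) as [|[|]]; reflexivity.
Qed.

Lemma PR_if C F G : PRb C -> PR F -> PR G -> PR (fun p x => if C p x then F p x else G p x).
Proof.
  intros HC HF HG.
  apply PR_ext with (fun p x => Nat.b2n (C p x) * F p x + (1 - Nat.b2n (C p x)) * G p x).
  - apply PR_add; apply PR_mul; auto. apply PR_sub; auto. apply PR_const.
  - intros; destruct (C p x); simpl; lia.
Qed.

Lemma PRb_if C F G : PRb C -> PRb F -> PRb G -> PRb (fun p x => if C p x then F p x else G p x).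
Proof.
  intros HC HF HG. eapply PR_ext. apply (PR_if _ _ _ HC HF HG).
  intros; cbn beta; now destruct (C p x).
Qed.

Lemma PRb_const b : PRb (fun _ _ => b).
Proof. exact (PR_const (Nat.b2n b)). Qed.

Lemma PRb_neg C : PRb C -> PRb (fun p x => negb (C p x)).
Proof. intros H. exact (PRb_if _ _ _ H (PRb_const false) (PRb_const true)). Qed.

Lemma PRb_and C D : PRb C -> PRb D -> PRb (fun p x => C p x && D p x).
Proof. intros H K. exact (PRb_if _ _ _ H K (PRb_const false)). Qed.

Lemma PRb_or C D : PRb C -> PRb D -> PRb (fun p x => C p x || D p x).
Proof. intros H K. exact (PRb_if _ _ _ H (PRb_const true) K). Qed.

Lemma PRb_ext F G : PRb F -> (forall p x, F p x = G p x) -> PRb G.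
Proof. intros H E. eapply PR_ext. apply H. intros; cbn beta; now rewrite E. Qed.

Lemma PRb_beq C D : PRb C -> PRb D -> PRb (fun p x => Bool.eqb (C p x) (D p x)).
Proof.
  intros H K. eapply PRb_ext. apply (PRb_if _ _ _ H K (PRb_neg _ K)).
  intros; cbn beta; now destruct (C p x), (D p x).
Qed.

Lemma PRb_xor C D : PRb C -> PRb D -> PRb (fun p x => xorb (C p x) (D p x)).
Proof.
  intros H K. eapply PRb_ext. apply (PRb_if _ _ _ H (PRb_neg _ K) K).
  intros; cbn beta; now destruct (C p x), (D p x).
Qed.

Lemma PRb_leb F G : PR F -> PR G -> PRb (fun p x => F p x <=? G p x).
Proof.
  intros HF HG. eapply PRb_ext. apply (PRb_eq0 _ (PR_sub _ _ HF HG)).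
  intros p x; cbn beta. apply eq_true_iff_eq.
  rewrite Nat.eqb_eq, Nat.leb_le; lia.
Qed.

Lemma PRb_ltb F G : PR F -> PR G -> PRb (fun p x => F p x <? G p x).
Proof. intros HF HG. exact (PRb_leb _ _ (PR_S _ HF) HG). Qed.

Lemma PRb_eqb F G : PR F -> PR G -> PRb (fun p x => F p x =? G p x).
Proof.
  intros HF HG. eapply PRb_ext. apply (PRb_and _ _ (PRb_leb _ _ HF HG) (PRb_leb _ _ HG HF)).
  intros p x; cbn beta. apply eq_true_iff_eq.
  rewrite andb_true_iff, Nat.eqb_eq, !Nat.leb_le; lia.
Qed.

Lemma PRb_odd G : PR G -> PRb (fun p x => Nat.odd (G p x)).
Proof.
  intros HG. apply PR_ext with (fun p x => rec 0 (fun _ r => 1 - r) (G p x)).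
  - apply PR_rec; [apply PR_O|auto|].
    apply PR_sub; [apply PR_const|apply PR_pi2, PR_snd].
  - intros. induction (G p x); [auto|]. rewrite rec_S, IHn, Nat.odd_succ, <- Nat.negb_odd.
    now destruct (Nat.odd n).
Qed.

Lemma PRb_even G : PR G -> PRb (fun p x => Nat.even (G p x)).
Proof.
  intros HG. eapply PRb_ext. apply (PRb_neg _ (PRb_odd _ HG)).
  intros; apply Nat.negb_odd.
Qed.

Lemma div2_succ n : Nat.div2 (S n) = Nat.div2 n + Nat.b2n (Nat.odd n).
Proof.
  pose proof (Nat.div2_odd n); pose proof (Nat.div2_odd (S n)).
  rewrite Nat.odd_succ, <- Nat.negb_odd in H0. destruct (Nat.odd n); simpl in *; lia.
Qed.

Lemma PR_div2 G : PR G -> PR (fun p x => Nat.div2 (G p x)).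
Proof.
  intros HG.
  apply PR_ext with (fun p x => rec 0 (fun i r => r + Nat.b2n (Nat.odd i)) (G p x)).
  - apply PR_rec; [apply PR_O|auto|].
    apply PR_add; [apply PR_pi2, PR_snd|].
    apply (PRb_odd (fun _ z => pi1 (pi2 z))), PR_pi1, PR_snd.
  - intros. induction (G p x); [auto|]. rewrite div2_succ, <- IHn. reflexivity.
Qed.

Definition bex (n : nat) (f : nat -> bool) : bool :=
  negb (rec 0 (fun i r => r + Nat.b2n (f i)) n =? 0).

Lemma bex_true n f : bex n f = true <-> exists i, i < n /\ f i = true.
Proof.
  unfold bex. rewrite negb_true_iff, Nat.eqb_neq.
  induction n.
  - split; [easy|]. intros (i & Hi & _); lia.
  - rewrite rec_S; cbn beta. split.
    + intros H. destruct (f n) eqn:E; [exists n; auto|].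
      simpl in H. rewrite Nat.add_0_r in H. apply IHn in H as (i & Hi & Hf). exists i; auto.
    + intros (i & Hi & Hf). destruct (Nat.eq_dec i n) as [->|].
      * rewrite Hf; simpl; lia.
      * enough (rec 0 (fun i r => r + Nat.b2n (f i)) n <> 0) by lia.
        apply IHn; exists i; split; auto; lia.
Qed.

Lemma PRb_bex N F : PR N -> PRb (fun p z => F p (pi1 z) (pi2 z)) ->
  PRb (fun p x => bex (N p x) (F p x)).
Proof.
  intros HN HF. apply PRb_neg, PRb_eq0. apply PR_rec; [apply PR_O|auto|].
  apply PR_add; [apply PR_pi2, PR_snd|].
  apply (PR2_app (fun p a b => Nat.b2n (F p a b)) _ _ HF); [apply PR_fst|apply PR_pi1, PR_snd].
Qed.

(** The words of length [k] have the codes from [2 ^ k - 1] up to [2 ^ (k + 1) - 2]. *)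
Definition len (v : nat) : nat := Nat.log2 (S v).

Lemma PR_len G : PR G -> PR (fun p x => len (G p x)).
Proof.
  intros HG.
  apply PR_ext with
    (fun p x => rec 0 (fun i r => if 2 ^ S r <=? S (S i) then S r else r) (G p x)).
  - apply PR_rec; [apply PR_O|auto|].
    apply (PR_if (fun _ z => 2 ^ S (pi2 (pi2 z)) <=? S (S (pi1 (pi2 z))))).
    + apply PRb_leb. apply PR_pow2, PR_S, PR_pi2, PR_snd. apply PR_S, PR_S, PR_pi1, PR_snd.
    + apply PR_S, PR_pi2, PR_snd.
    + apply PR_pi2, PR_snd.
  - intros. unfold len. induction (G p x) as [|m IH]; [reflexivity|].
    rewrite rec_S, IH. pose proof (Nat.log2_spec (S m) ltac:(lia)).
    pose proof (Nat.log2_spec (S (S m)) ltac:(lia)).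
    destruct (Nat.log2_succ_or (S m)) as [E|E]; rewrite E in *;
      destruct (Nat.leb_spec (2 ^ S (Nat.log2 (S m))) (S (S m))); lia.
Qed.

Ltac pr := repeat (cbn beta; lazymatch goal with
  | H : PR ?G |- PR ?G => exact H
  | H : PRb ?G |- PRb ?G => exact H
  | |- PR (fun _ _ => Nat.b2n _) => apply PR_PRb
  | |- PR (fun _ x => x) => apply PR_id
  | |- PR (fun p => p) => apply PR_oracle
  | |- PR (fun _ _ => ?c) => apply (PR_const c)
  | |- PRb (fun _ _ => ?c) => apply (PRb_const c)
  | |- PR (fun _ _ => if _ then _ else _) => apply PR_if
  | |- PRb (fun _ _ => if _ then _ else _) => apply PRb_if
  | |- PR (fun _ _ => pi1 _) => apply PR_pi1
  | |- PR (fun _ _ => pi2 _) => apply PR_pi2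
  | |- PR (fun _ _ => npair _ _) => apply PR_npair
  | |- PR (fun _ _ => S _) => apply PR_S
  | |- PR (fun _ _ => pred _) => apply PR_pred
  | |- PR (fun _ _ => _ + _) => apply PR_add
  | |- PR (fun _ _ => _ - _) => apply PR_sub
  | |- PR (fun _ _ => 2 ^ _) => apply PR_pow2
  | |- PR (fun _ _ => _ * _) => apply PR_mul
  | |- PR (fun _ _ => Nat.div2 _) => apply PR_div2
  | |- PR (fun _ _ => len _) => apply PR_len
  | |- PR (fun _ _ => rec _ _ _) => apply PR_rec
  | |- PRb (fun _ _ => negb _) => apply PRb_neg
  | |- PRb (fun _ _ => _ && _) => apply PRb_and
  | |- PRb (fun _ _ => _ || _) => apply PRb_or
  | |- PRb (fun _ _ => Bool.eqb _ _) => apply PRb_beq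
  | |- PRb (fun _ _ => xorb _ _) => apply PRb_xor
  | |- PRb (fun _ _ => _ =? _) => apply PRb_eqb
  | |- PRb (fun _ _ => _ <=? _) => apply PRb_leb
  | |- PRb (fun _ _ => _ <? _) => apply PRb_ltb
  | |- PRb (fun _ _ => Nat.odd _) => apply PRb_odd
  | |- PRb (fun _ _ => Nat.even _) => apply PRb_even
  | |- PRb (fun _ _ => bex _ _) => apply PRb_bex
  | |- PR (fun p _ => p _) => apply PR_oracle_app
  | H : PR ?F |- PR (fun p x => ?F p _) => apply (PR_comp _ _ H)
  | H : PRb ?F |- PRb (fun p x => ?F p _) => apply (PR_comp _ _ H)
  | H : PR2 ?F |- PR (fun p x => ?F p _ _) => apply (PR2_app _ _ _ H)
  | H : PRb (fun p z => ?F p (pi1 z) (pi2 z)) |- PRb (fun p x => ?F p _ _) => apply (PR2_app (fun p a b => Nat.b2n (F p a b)) _ _ H)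
  | |- _ => fail "stuck"
  end).

(** ** Words and positions *)

(** Inverse of [word_of_nat]; appending a letter adds it in the most significant place. *)
Fixpoint enc (w : list bool) : nat :=
  match w with [] => 0 | b :: w' => 2 * enc w' + 1 + Nat.b2n b end.

Lemma even_enc_cons (b : bool) e : Nat.even (2 * e + 1 + Nat.b2n b) = b.
Proof.
  replace (2 * e + 1 + Nat.b2n b) with (1 + Nat.b2n b + 2 * e) by lia.
  rewrite Nat.even_add_mul_2. now destruct b.
Qed.

Lemma div2_enc_cons (b : bool) e : Nat.div2 (2 * e + Nat.b2n b) = e.
Proof.
  rewrite Nat.div2_div. symmetry. apply Nat.div_unique with (Nat.b2n b); destruct b; simpl; lia.
Qed.

Lemma word_enc w : word_of_nat (enc w) = w.
Proof.
  unfold word_of_nat.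
  enough (H : forall f, enc w <= f -> word_aux f (enc w) = w) by (apply H; lia).
  induction w as [|b w IH]; intros f Hf.
  - now destruct f.
  - cbn [enc] in *. destruct f as [|f]; [lia|].
    destruct (2 * enc w + 1 + Nat.b2n b) as [|m] eqn:E; [lia|].
    cbn [word_aux]. rewrite <- E, even_enc_cons. f_equal.
    replace m with (2 * enc w + Nat.b2n b) by lia. rewrite div2_enc_cons. apply IH; lia.
Qed.

Lemma enc_word n : enc (word_of_nat n) = n.
Proof.
  unfold word_of_nat.
  enough (H : forall f m, m <= f -> enc (word_aux f m) = m) by (apply H; lia).
  induction f as [|f IH]; intros [|m] Hm; try reflexivity; [lia|].
  cbn [word_aux enc]. pose proof (Nat.div2_odd m) as E.
  rewrite IH by (destruct (Nat.odd m); simpl in E; lia).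
  rewrite Nat.even_succ. lia.
Qed.

Lemma len_enc w : len (enc w) = length w.
Proof.
  unfold len. induction w as [|b w IH]; [reflexivity|].
  cbn [enc length]. rewrite <- IH. destruct b; simpl Nat.b2n.
  - replace (S (2 * enc w + 1 + 1)) with (2 * S (enc w) + 1) by lia.
    apply Nat.log2_succ_double; lia.
  - replace (S (2 * enc w + 1 + 0)) with (2 * S (enc w)) by lia.
    apply Nat.log2_double; lia.
Qed.

Lemma length_word n : length (word_of_nat n) = len n.
Proof. now rewrite <- (enc_word n) at 2; rewrite len_enc. Qed.

Lemma enc_app a b : enc (a ++ b) = enc a + 2 ^ length a * enc b.
Proof.
  induction a as [|c a IH]; cbn [app enc length]; [simpl; lia|].
  rewrite IH, Nat.pow_succ_r'. lia.
Qed.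

Definition snoc (v : nat) (b : bool) : nat := v + 2 ^ len v * S (Nat.b2n b).

Lemma enc_snoc w b : enc (w ++ [b]) = snoc (enc w) b.
Proof. rewrite enc_app. unfold snoc. rewrite len_enc. destruct b; reflexivity. Qed.

Lemma snoc_gt v b : v < snoc v b.
Proof.
  unfold snoc. assert (2 ^ len v <> 0) by (apply Nat.pow_nonzero; lia). nia.
Qed.

Definition pos (x : nat -> bool) (k : nat) : nat := enc (prefix x k).

Lemma prefix_S x k : prefix x (S k) = prefix x k ++ [x k].
Proof. unfold prefix. now rewrite seq_S, map_app. Qed.

Lemma length_prefix x k : length (prefix x k) = k.
Proof. unfold prefix. now rewrite length_map, length_seq. Qed.

Lemma pos_0 x : pos x 0 = 0.
Proof. reflexivity. Qed.

Lemma pos_S x k : pos x (S k) = snoc (pos x k) (x k).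
Proof. unfold pos. rewrite prefix_S. apply enc_snoc. Qed.

Lemma len_pos x k : len (pos x k) = k.
Proof. unfold pos. rewrite len_enc. apply length_prefix. Qed.

Lemma len_snoc v b : len (snoc v b) = S (len v).
Proof.
  rewrite <- (enc_word v), <- enc_snoc, !len_enc, length_app; simpl; lia.
Qed.

Lemma pos_ge x k : k <= pos x k.
Proof.
  induction k; [lia|]. rewrite pos_S. pose proof (snoc_gt (pos x k) (x k)). lia.
Qed.

Lemma prefix_word x k : prefix x k = word_of_nat (pos x k).
Proof. unfold pos. now rewrite word_enc. Qed.

Lemma prefix_app x i j : i <= j -> exists w, prefix x j = prefix x i ++ w.
Proof.
  intros H. exists (map x (seq i (j - i))). unfold prefix.
  rewrite <- map_app. f_equal. rewrite <- seq_app with (start := 0). f_equal; lia.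
Qed.

Lemma in_cyl_pos x k : in_cyl (word_of_nat k) x <-> exists j, pos x j = k.
Proof.
  unfold in_cyl. rewrite length_word. split.
  - intros H. exists (len k). unfold pos. rewrite H. apply enc_word.
  - intros (j & <-). now rewrite len_pos, prefix_word.
Qed.

(** Later letters occupy more significant places, so extending word [k] means adding a multiple of
    [2 ^ len k]; [e] codes the letters that follow. *)
Lemma pos_extends x k j : len k <= j -> in_cyl (word_of_nat k) x ->
  exists e, e <= pos x j /\ pos x j = k + 2 ^ len k * e.
Proof.
  intros Hj Hc. unfold in_cyl in Hc. rewrite length_word in Hc.
  destruct (prefix_app x (len k) j Hj) as (w & Hw). rewrite Hc in Hw.
  exists (enc w). unfold pos. rewrite Hw, enc_app, enc_word, length_word. split; auto.
  assert (2 ^ len k <> 0) by (apply Nat.pow_nonzero; lia). nia.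
Qed.

Lemma extends_in_cyl x k j e : pos x j = k + 2 ^ len k * e -> in_cyl (word_of_nat k) x.
Proof.
  intros H. assert (E : prefix x j = word_of_nat k ++ word_of_nat e).
  { rewrite prefix_word, H, <- (word_enc (_ ++ _)). f_equal.
    now rewrite enc_app, !enc_word, length_word. }
  unfold in_cyl.
  assert (Hl : length (word_of_nat k) <= j).
  { rewrite <- (length_prefix x j), E, length_app. lia. }
  destruct (prefix_app x _ _ Hl) as (w & Hw). rewrite E in Hw.
  assert (F : forall n (l l' : list bool), length l = n -> firstn n (l ++ l') = l).
  { intros n l l' <-. rewrite firstn_app, Nat.sub_diag, firstn_all, firstn_O. apply app_nil_r. }
  apply (f_equal (firstn (length (word_of_nat k)))) in Hw.
  rewrite !F in Hw by (auto using length_prefix). congruence.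
Qed.

Definition wtl (v : nat) : nat := Nat.div2 (pred v).
Definition bit (v i : nat) : bool :=
  let m := rec v (fun _ r => wtl r) i in negb (m =? 0) && Nat.even m.

Lemma bit_enc w i : bit (enc w) i = nth i w false.
Proof.
  unfold bit.
  assert (H : forall j, rec (enc w) (fun _ r => wtl r) j = enc (skipn j w)).
  { induction j as [|j IH]; [reflexivity|]. rewrite rec_S, IH.
    replace (S j) with (1 + j) by lia. rewrite <- skipn_skipn.
    destruct (skipn j w) as [|b u]; [reflexivity|].
    unfold wtl. cbn [enc skipn].
    replace (pred (2 * enc u + 1 + Nat.b2n b)) with (2 * enc u + Nat.b2n b) by lia.
    apply div2_enc_cons. }
  rewrite H. pose proof (nth_skipn i w 0 false) as E. rewrite Nat.add_0_r in E. rewrite <- E.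
  destruct (skipn i w) as [|b u]; [reflexivity|]. cbn [enc nth].
  rewrite even_enc_cons. now destruct (Nat.eqb_spec (2 * enc u + 1 + Nat.b2n b) 0); [lia|].
Qed.

Lemma bit_pos x k i : i < k -> bit (pos x k) i = x i.
Proof.
  intros H. unfold pos, prefix. rewrite bit_enc.
  rewrite nth_indep with (d' := x 0) by (rewrite length_map, length_seq; lia).
  rewrite map_nth, seq_nth; auto.
Qed.

(** ** Backward induction on a truncated game tree *)

(** Lists are right-nested pairs ending in [0]. Both projections of [0] are [0], so an access beyond
    the end gives [false]. *)
Definition lookup (h k : nat) : bool := pi1 (rec h (fun _ r => pi2 r) k) =? 1.

(** Codes of words increase along branches, so a recursion from a node to its two successors,
    cut off at codes [>= M], is evaluated by listing the nodes [M - 1, M - 2, ...] and keeping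
    all earlier values as a nested pair. *)
Definition table (rule : nat -> bool -> bool -> bool) (M s : nat) : nat :=
  rec 0 (fun s h => let v := M - 1 - s in
    npair (Nat.b2n (rule v (lookup h (snoc v false - v - 1)) (lookup h (snoc v true - v - 1)))) h) s.

Definition backward (rule : nat -> bool -> bool -> bool) (M v : nat) : bool :=
  lookup (table rule M (M - v)) 0.

Lemma lookup_table rule M s k : lookup (table rule M s) k = lookup (table rule M (s - k)) 0.
Proof.
  unfold lookup. rewrite rec_0. f_equal. f_equal.
  induction k as [|k IH]; [rewrite rec_0; f_equal; lia|].
  rewrite rec_S, IH. unfold table at 1. destruct (s - k) as [|m] eqn:E.
  - rewrite rec_0, pi2_0. replace (s - S k) with 0 by lia. reflexivity.
  - rewrite rec_S. cbv zeta. rewrite pi2_npair. replace (s - S k) with m by lia. reflexivity.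
Qed.

(** When [v] is treated, the list starts with node [v + 1], so a successor [u] sits at place
    [u - v - 1]; one beyond the cut-off is not listed and counts as [false]. *)
Lemma backward_eq rule M v : v < M -> backward rule M v = rule v (backward rule M (snoc v false)) (backward rule M (snoc v true)).
Proof.
  intros H. unfold backward at 1. unfold table.
  replace (M - v) with (S (M - v - 1)) by lia. rewrite rec_S. cbv zeta.
  fold (table rule M (M - v - 1)). replace (M - 1 - (M - v - 1)) with v by lia.
  unfold backward. rewrite !(lookup_table rule M (M - v - 1)).
  pose proof (snoc_gt v false); pose proof (snoc_gt v true).
  replace (M - v - 1 - (snoc v false - v - 1)) with (M - snoc v false) by lia.
  replace (M - v - 1 - (snoc v true - v - 1)) with (M - snoc v true) by lia.
  unfold lookup at 1. rewrite rec_0, pi1_npair.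
  destruct (rule v _ _); reflexivity.
Qed.

Lemma backward_ge rule M v : M <= v -> backward rule M v = false.
Proof.
  intros H. unfold backward. replace (M - v) with 0 by lia.
  unfold lookup, table. now rewrite !rec_0, pi1_0.
Qed.

Lemma backward_lt rule M v : backward rule M v = true -> v < M.
Proof.
  intros H. destruct (Nat.lt_ge_cases v M); auto. rewrite backward_ge in H; easy.
Qed.

Definition truth (P : Prop) : bool := if excluded_middle_informative P then true else false.

Lemma truth_iff P : truth P = true <-> P.
Proof. unfold truth. destruct excluded_middle_informative; split; auto; easy. Qed.

Lemma not_true b : b <> true -> b = false.
Proof. now destruct b. Qed.

(** ** Analysis of difference games *)

Section Difference_game.

(** Players are Booleans, [true] being player 1; [tn v] is the player to move at the position with
    code [v]. *)
Variables (n : nat) (tn : nat -> bool) (I : nat -> nat -> bool).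

Definition owner (beta : nat) : bool := xorb (Nat.odd beta) (Nat.odd (S n)).

(** [I beta v]: some [U_gamma] with [gamma < beta] is entered by [v].  [owner beta] says whether
    player 1 wins the plays whose least index is [beta].  In the level [beta] game the player
    [negb (owner beta)] attacks: he wants to enter [U_gamma] for some [gamma < beta] at a node
    where the attacker of level [beta - 1] (his opponent) does not win; [w] answers this. *)
Definition rule (w : nat -> bool) (beta v : nat) (c0 c1 : bool) : bool :=
  if I beta v then negb (w v)
  else if Bool.eqb (tn v) (negb (owner beta)) then c0 || c1 else c0 && c1.

Definition forced (w : nat -> bool) (beta M v : nat) : bool := backward (rule w beta) M v.

(** The move [b] at [v] is a misstep, witnessed by [M], if the attacker of the current level
    could have moved to a successor that is won at a strictly smaller cut-off, or if his opponent
    moves to such a successor although the other one is not won at cut-off [M]. *)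
Definition misstep (w : nat -> nat -> bool) (v : nat) (b : bool) (M : nat) : bool :=
  bex (S (S n)) (fun beta =>
    ((beta =? S n) || I (S beta) v) && negb (I beta v) &&
    (if Bool.eqb (tn v) (negb (owner beta))
     then forced (w (pred beta)) beta M (snoc v (negb b)) && negb (forced (w (pred beta)) beta M (snoc v b))
     else forced (w (pred beta)) beta M (snoc v b) && negb (forced (w (pred beta)) beta M (snoc v (negb b))))).

Fixpoint wins (beta v : nat) : bool :=
  match beta with
  | 0 => false
  | S b => truth (exists M, forced (wins b) (S b) M v = true)
  end.

(** As [wins], with the recursion replaced by [i] uniform limit steps; correct for levels [<= i]
    ([wins_stage_eq]). *)
Fixpoint wins_stage (i beta v : nat) : bool :=
  match i with
  | 0 => false
  | S j => truth (exists M, forced (wins_stage j (pred beta)) beta M v = true)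
  end.

Definition forced_by (beta : nat) : nat -> nat -> bool := forced (wins (pred beta)) beta.

Definition outcome (x : nat -> bool) (beta : nat) : Prop :=
  beta <= S n /\ (beta = S n \/ exists k, I (S beta) (pos x k) = true) /\
  forall k, I beta (pos x k) = false.

Definition follows (x s : nat -> bool) (i : bool) (k : nat) : Prop :=
  forall j, k <= j -> tn (pos x j) = i -> x j = s (pos x j).

Hypothesis I_0 : forall v, I 0 v = false.
Hypothesis I_snoc : forall beta v b, I beta v = true -> I beta (snoc v b) = true.
Hypothesis I_S : forall beta v, I beta v = true -> I (S beta) v = true.

Lemma forced_eq w beta M v : v < M -> forced w beta M v =
  if I beta v then negb (w v)
  else if Bool.eqb (tn v) (negb (owner beta))
  then forced w beta M (snoc v false) || forced w beta M (snoc v true)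
  else forced w beta M (snoc v false) && forced w beta M (snoc v true).
Proof. apply backward_eq. Qed.

Lemma forced_0 w M v : forced w 0 M v = false.
Proof.
  unfold forced. remember (M - v) as f eqn:E. assert (H : M - v <= f) by (subst; apply le_n). clear E.
  revert v H; induction f as [|f IH]; intros v H.
  - apply backward_ge; lia.
  - destruct (Nat.lt_ge_cases v M); [|apply backward_ge; lia].
    rewrite backward_eq by auto. pose proof (snoc_gt v false); pose proof (snoc_gt v true).
    rewrite !IH by lia. unfold rule. rewrite I_0. now destruct (Bool.eqb _ _).
Qed.

Lemma wins_stage_eq i beta : beta <= i -> wins_stage i beta = wins beta.
Proof.
  revert beta; induction i as [|i IH]; intros [|b] H; try reflexivity; [lia| |].
  - apply functional_extensionality; intro v. cbn [wins_stage wins].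
    apply not_true; rewrite truth_iff; intros [M HM]. now rewrite forced_0 in HM.
  - cbn [wins_stage wins pred]. rewrite IH by lia. reflexivity.
Qed.

(** [rule] is monotone in the values of the two successors, and raising the cut-off only replaces
    default values [false]. *)
Lemma forced_mono w beta M M' v : M <= M' -> forced w beta M v = true -> forced w beta M' v = true.
Proof.
  intros HM. unfold forced. remember (M - v) as f eqn:E. assert (H : M - v <= f) by (subst; apply le_n). clear E.
  revert v H; induction f as [|f IH]; intros v H K; pose proof (backward_lt _ _ _ K); [lia|].
  rewrite backward_eq in K |- * by lia. pose proof (snoc_gt v false); pose proof (snoc_gt v true).
  unfold rule in *. destruct (I beta v); auto.
  destruct (Bool.eqb _ _).
  - apply orb_true_iff in K as [K|K]; apply IH in K; try lia; rewrite K; auto using orb_true_r.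
  - apply andb_true_iff in K as [K L]; apply IH in K, L; try lia. now rewrite K, L.
Qed.

Lemma wins_iff beta v : wins beta v = true <-> exists M, forced_by beta M v = true.
Proof.
  destruct beta as [|b]; unfold forced_by.
  - simpl. split; [easy|]. intros [M HM]. now rewrite forced_0 in HM.
  - apply truth_iff.
Qed.

(** An entered node passes to level [b], where the former attacker defends; this needs no
    look-ahead, so the cut-off [S v] suffices. *)
Lemma wins_entered b v : I (S b) v = true -> wins (S b) v = negb (wins b v).
Proof.
  intros H. apply eq_true_iff_eq. rewrite wins_iff. unfold forced_by, forced. simpl pred. split.
  - intros [M HM]. pose proof (backward_lt _ _ _ HM). rewrite backward_eq in HM by auto.
    unfold rule in HM. now rewrite H in HM.
  - intros K. exists (S v). rewrite backward_eq by lia. unfold rule. now rewrite H.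
Qed.

Lemma I_pos beta x k k' : k <= k' -> I beta (pos x k) = true -> I beta (pos x k') = true.
Proof.
  induction 1; auto. intros K. rewrite pos_S. auto.
Qed.

Lemma I_le beta beta' v : beta <= beta' -> I beta v = true -> I beta' v = true.
Proof. induction 1; auto. Qed.

Lemma misstep_false w v b M beta : misstep w v b M = false -> beta <= S n ->
  beta = S n \/ I (S beta) v = true -> I beta v = false ->
  if Bool.eqb (tn v) (negb (owner beta))
  then forced (w (pred beta)) beta M (snoc v (negb b)) = true -> forced (w (pred beta)) beta M (snoc v b) = true
  else forced (w (pred beta)) beta M (snoc v b) = true -> forced (w (pred beta)) beta M (snoc v (negb b)) = true.
Proof.
  intros H Hb Hl Hi.
  destruct (Bool.eqb _ _) eqn:E; intros K; apply NNPP; intros L; apply not_true in L;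
  enough (misstep w v b M = true) by congruence; apply bex_true; exists beta; (split; [lia|]);
  rewrite Hi, E, K, L, !andb_true_iff, orb_true_iff, Nat.eqb_eq; auto.
Qed.

(** If both moves were missteps, each successor would be won at a cut-off at which the other is not.
    Lifting the win at the smaller cut-off to the larger one by [forced_mono] gives a
    contradiction. *)
Lemma good_exists w v : exists b, forall M, misstep w v b M = false.
Proof.
  destruct (classic (exists beta, beta <= S n /\ (beta = S n \/ I (S beta) v = true) /\ I beta v = false))
    as [(beta & Hb & Hl & Hi)|N].
  - set (f M b := forced (w (pred beta)) beta M (snoc v b)).
    set (a := Bool.eqb (tn v) (negb (owner beta))).
    assert (H : forall b M, misstep w v b M = true ->
      f M (if a then negb b else b) = true /\ f M (if a then b else negb b) = false).
    { intros b M K. apply bex_true in K as (beta' & Hb' & K).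
      rewrite !andb_true_iff, orb_true_iff, Nat.eqb_eq, negb_true_iff in K.
      destruct K as [[K1 K2] K3].
      assert (beta' = beta).
      { destruct (Nat.lt_trichotomy beta beta') as [L|[L|L]]; auto.
        - destruct Hl as [->|Hl]; [lia|]. apply (I_le _ beta') in Hl; [congruence|lia].
        - destruct K1 as [->|K1]; [lia|]. apply (I_le _ beta) in K1; [congruence|lia]. }
      subst beta'. fold a in K3. unfold f. destruct a;
      now apply andb_true_iff in K3 as [K3 K4%negb_true_iff]. }
    destruct (classic (exists M, misstep w v true M = true)) as [[M K]|K].
    + exists false. intros M'. apply not_true; intros L. apply H in K, L.
      destruct K as [K1 K2], L as [L1 L2]. unfold f in *.
      destruct (Nat.le_ge_cases M M') as [E|E].
      * destruct a; simpl in *; apply (forced_mono _ _ _ M') in K1; auto; congruence.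
      * destruct a; simpl in *; apply (forced_mono _ _ _ M) in L1; auto; congruence.
    + exists true. intros M. apply not_true; eauto.
  - exists true. intros M. apply not_true; intros K. apply bex_true in K as (beta' & Hb' & K).
    rewrite !andb_true_iff, orb_true_iff, Nat.eqb_eq, negb_true_iff in K.
    apply N. exists beta'. intuition lia.
Qed.

(** Induction on the level. [i] is the predicted winner: the attacker at a won position, otherwise
    his opponent. Without missteps the prediction persists until the level drops, and there
    [wins_entered] matches the exchange of roles. *)
Lemma good_strategy_wins s (Hs : forall v M, misstep wins v (s v) M = false) beta :
  forall x k i, beta <= S n -> beta = S n \/ I (S beta) (pos x k) = true ->
  follows x s i k -> wins beta (pos x k) = Bool.eqb i (negb (owner beta)) ->
  exists beta', outcome x beta' /\ owner beta' = i.
Proof.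
  induction beta as [beta IH] using lt_wf_ind. intros x k i Hb Hl Hf Hu.
  assert (Hl' : forall k', k <= k' -> beta = S n \/ I (S beta) (pos x k') = true).
  { intros k' Hk. destruct Hl as [|Hl]; auto. right. eapply I_pos; eauto. }
  assert (Hgood : forall k', k <= k' -> I beta (pos x k') = false -> forall M, _) by
    (intros k' Hk Hi M; exact (misstep_false _ _ _ M beta (Hs (pos x k') M) Hb (Hl' k' Hk) Hi)).
  (* The same cut-off [M] survives the move, so the attacker cannot postpone his entry forever. *)
  assert (Hstep : forall k' M, k <= k' -> I beta (pos x k') = false -> i = negb (owner beta) ->
            forced_by beta M (pos x k') = true -> forced_by beta M (pos x (S k')) = true).
  { intros k' M Hk Hi Ha HV. specialize (Hgood k' Hk Hi M). rewrite pos_S.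
    unfold forced_by in *. pose proof (backward_lt _ _ _ HV). rewrite forced_eq, Hi in HV by auto.
    destruct (Bool.eqb (tn _) _) eqn:E.
    - apply eqb_prop in E. rewrite (Hf k') by (auto; congruence).
      apply orb_true_iff in HV as [HV|HV]; destruct (s (pos x k')); auto.
    - apply andb_true_iff in HV as [? ?]. destruct (x k'); auto. }
  destruct (classic (exists k', k <= k' /\ I beta (pos x k') = true)) as [(k' & Hk & HI)|N].
  - destruct (dec_inh_nat_subset_has_unique_least_element
      (fun k' => k <= k' /\ I beta (pos x k') = true)) as (k1 & ((Hk1 & HI1) & Hmin) & _).
    { intros; apply classic. } { eauto. }
    assert (Hinv : forall j, k <= j -> j <= k1 -> wins beta (pos x j) = Bool.eqb i (negb (owner beta))).
    { induction 1 as [|j Hj IHj]; auto. intros Hle.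
      assert (HIj : I beta (pos x j) = false).
      { apply not_true; intros HIj. enough (k1 <= j) by lia. auto. }
      specialize (IHj ltac:(lia)). apply eq_true_iff_eq.
      rewrite wins_iff, Bool.eqb_true_iff. split.
      (* A defender who moves to a won successor without misstep has no better one, so the current
         position would be won already. *)
      - intros [M HM]. apply NNPP; intros Ha.
        assert (Hf0 : wins beta (pos x j) = false).
        { rewrite IHj. now apply Bool.eqb_false_iff. }
        assert (K : forall M, forced_by beta M (pos x j) <> true).
        { intros M' K. enough (wins beta (pos x j) = true) by congruence. apply wins_iff; eauto. }
        specialize (Hgood j Hj HIj M). rewrite pos_S in HM.
        pose proof (backward_lt _ _ _ HM). pose proof (snoc_gt (pos x j) (x j)).
        apply (K M). unfold forced_by in *. rewrite forced_eq, HIj by lia. clear IHj.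
        destruct (Bool.eqb (tn _) _) eqn:E.
        + destruct (x j); rewrite HM; auto using orb_true_r.
        + rewrite (Hf j Hj) in HM.
          * specialize (Hgood HM).
            destruct (s (pos x j)); simpl in Hgood; now rewrite HM, Hgood.
          * apply Bool.eqb_false_iff in E. destruct (tn (pos x j)), i, (owner beta); simpl in *; congruence.
      - intros Ha. rewrite Ha, Bool.eqb_reflx, wins_iff in IHj. destruct IHj as [M HM].
        exists M. apply Hstep; auto. }
    destruct beta as [|b]; [now rewrite I_0 in HI|].
    apply (IH b) with (k := k1); auto; [lia| |].
    + intros j Hj; apply Hf; lia.
    + specialize (Hinv k1 Hk1 (le_n _)). rewrite wins_entered in Hinv by auto.
      apply (f_equal negb) in Hinv. rewrite negb_involutive in Hinv. rewrite Hinv.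
      unfold owner. rewrite Nat.odd_succ, <- Nat.negb_odd.
      now destruct i, (Nat.odd b), (Nat.odd (S n)).
  (* The level is never left, so [beta] is the outcome. Were [i] the attacker, all later codes would
     stay below one [M], although codes are at least as large as lengths. *)
  - assert (Hno : forall k', I beta (pos x k') = false).
    { intros k'. apply not_true; intros K. apply N. exists (k + k'); split; [lia|].
      apply I_pos with k'; auto; lia. }
    exists beta. repeat split; auto.
    + destruct Hl; eauto.
    + apply NNPP; intros K. assert (Ha : i = negb (owner beta)) by now destruct i, (owner beta).
      rewrite Ha, Bool.eqb_reflx, wins_iff in Hu. destruct Hu as [M HM].
      assert (HM' : forall k', k <= k' -> forced_by beta M (pos x k') = true).
      { induction 1; auto. }
      specialize (HM' (k + M) ltac:(lia)). apply backward_lt in HM'.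
      pose proof (pos_ge x (k + M)); lia.
Qed.

End Difference_game.

(** ** The upper bounds *)

Definition left_half (r : B) : B := fun m => r (2 * m).
Definition right_half (r : B) : B := fun m => r (2 * m + 1).

Lemma left_bjoin p q : left_half (bjoin p q) = p.
Proof.
  apply functional_extensionality; intro m. unfold left_half, bjoin.
  now rewrite Nat.even_even, Nat.div2_double.
Qed.

Lemma right_bjoin p q : right_half (bjoin p q) = q.
Proof.
  apply functional_extensionality; intro m. unfold right_half, bjoin.
  rewrite Nat.add_1_r, Nat.even_succ, Nat.odd_even, Nat.div2_succ_double; auto.
Qed.

Lemma bex_ext n f g : (forall i, i < n -> f i = g i) -> bex n f = bex n g.
Proof.
  intros H. apply eq_true_iff_eq. rewrite !bex_true.
  split; intros (i & Hi & K); exists i; split; auto; rewrite <- K; [symmetry|]; auto.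
Qed.

(** * Difference games read off their names *)

Definition turn_name (p : B) (v : nat) : bool := p (2 * v) =? 1.

(** Only list entries before place [v] are consulted, which makes entering decidable; as codes grow
    along a play, every listed word is noticed eventually. *)
Definition entered (p : B) (beta v : nat) : bool :=
  bex beta (fun gamma => bex v (fun j => bex (S v) (fun e =>
    negb (p (2 * npair gamma j + 1) =? 0) &&
    (v =? pred (p (2 * npair gamma j + 1)) + 2 ^ len (pred (p (2 * npair gamma j + 1))) * e)))).

Lemma entered_true p beta v : entered p beta v = true <->
  exists gamma j k e, gamma < beta /\ j < v /\ p (2 * npair gamma j + 1) = S k /\ v = k + 2 ^ len k * e.
Proof.
  unfold entered. rewrite bex_true. split.
  - intros (g & Hg & (j & Hj & (e & He & K)%bex_true)%bex_true).
    apply andb_true_iff in K as [K1%negb_true_iff%Nat.eqb_neq K2%Nat.eqb_eq].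
    destruct (p (2 * npair g j + 1)) as [|k] eqn:E; [easy|].
    exists g, j, k, e; auto.
  - intros (g & j & k & e & Hg & Hj & Hp & Hv). exists g; split; auto.
    apply bex_true; exists j; split; auto. apply bex_true; exists e.
    rewrite Hp; simpl pred; simpl negb. split.
    + assert (2 ^ len k <> 0) by (apply Nat.pow_nonzero; lia). nia.
    + now apply Nat.eqb_eq.
Qed.

Lemma entered_0 p v : entered p 0 v = false.
Proof. apply not_true; intros H. apply entered_true in H as (g & j & k & e & H & _); lia. Qed.

Lemma entered_S p beta v : entered p beta v = true -> entered p (S beta) v = true.
Proof.
  rewrite !entered_true. intros (g & j & k & e & H & K). exists g, j, k, e; split; auto.
Qed.

Lemma entered_snoc p beta v b : entered p beta v = true -> entered p beta (snoc v b) = true.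
Proof.
  rewrite !entered_true. intros (g & j & k & e & H1 & H2 & H3 & H4).
  exists g, j, k, (snoc e b). pose proof (snoc_gt v b). repeat split; auto; try lia.
  rewrite <- (enc_word k), <- (enc_word e), len_enc, <- enc_app in H4.
  rewrite H4, <- enc_snoc, <- app_assoc, enc_app, enc_snoc, !enc_word, length_word. reflexivity.
Qed.

Definition opens (p : B) (beta : nat) : Cantor -> Prop :=
  open_named (fun j => p (2 * npair beta j + 1)).

Lemma entered_opens p beta x :
  (exists k, entered p beta (pos x k) = true) <-> exists gamma, gamma < beta /\ opens p gamma x.
Proof.
  split.
  - intros (m & H). apply entered_true in H as (g & j & k & e & H1 & H2 & H3 & H4).
    exists g; split; auto. exists j, k; split; auto. eapply extends_in_cyl; eauto.
  (* Long enough to extend word [k] and to have a code above [j]. *)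
  - intros (g & Hg & j & k & Hp & Hc). exists (S (j + len k)).
    destruct (pos_extends x k (S (j + len k)) ltac:(lia) Hc) as (e & _ & He).
    apply entered_true. exists g, j, k, e. repeat split; auto.
    pose proof (pos_ge x (S (j + len k))); lia.
Qed.

Lemma outcome_opens n p x beta : outcome n (entered p) x beta <->
  beta <= S n /\ (beta = S n \/ opens p beta x) /\ forall gamma, gamma < beta -> ~ opens p gamma x.
Proof.
  unfold outcome. rewrite entered_opens.
  assert (E : (forall k, entered p beta (pos x k) = false) <->
              (forall gamma, gamma < beta -> ~ opens p gamma x)).
  { split.
    - intros H g Hg K. destruct (proj2 (entered_opens p beta x)) as (k & Hk); [eauto|]. congruence.
    - intros H k. apply not_true; intros K.
      destruct (proj1 (entered_opens p beta x)) as (g & Hg & Hk); [eauto|]. eapply H; eauto. }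
  rewrite E. split; intros (H1 & H2 & H3); repeat split; auto; destruct H2 as [H2|H2]; auto.
  - destruct H2 as (g & Hg & K). right. destruct (Nat.eq_dec g beta) as [->|]; auto.
    exfalso; apply (H3 g); auto; lia.
  - right; exists beta; split; auto.
Qed.

Lemma outcome_unique n I x beta beta' : outcome n I x beta -> outcome n I x beta' ->
  (forall b v, I b v = true -> I (S b) v = true) -> beta = beta'.
Proof.
  intros (H1 & H2 & H3) (K1 & K2 & K3) HS.
  assert (L : forall a b, a < b -> b <= S n -> (a = S n \/ exists k, I (S a) (pos x k) = true) ->
                     (forall k, I b (pos x k) = false) -> False).
  { intros a b Hab Hb [->|[k Hk]] Hn; [lia|]. apply (I_le I HS _ b) in Hk; [|lia]. congruence. }
  destruct (Nat.lt_trichotomy beta beta') as [E|[E|E]]; auto; exfalso; eauto.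
Qed.

Lemma owner_true n beta : owner n beta = true <-> Nat.odd beta <> Nat.odd (S n).
Proof. unfold owner. destruct (Nat.odd beta), (Nat.odd (S n)); simpl; split; congruence. Qed.

Lemma Dm_cond_outcome n p x :
  Dm_cond (S n) (opens p) x <-> exists beta, outcome n (entered p) x beta /\ owner n beta = true.
Proof.
  unfold Dm_cond. split; intros (b & H).
  - exists b. rewrite outcome_opens, owner_true. tauto.
  - exists b. rewrite outcome_opens, owner_true in H. tauto.
Qed.

Definition isP1 (i : player) : bool := match i with P1 => true | P2 => false end.

(** For player 2, lying outside the winning set becomes an outcome that he owns: the least entered
    index, or [S n] if there is none. *)
Lemma winning_outcome n p (G : game) i s : rep_game (rep_Dm (S n)) p G ->
  (winning G i s <-> forall x,
     follows (turn_name p) x (fun v => s (word_of_nat v)) (isP1 i) 0 ->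
     exists beta, outcome n (entered p) x beta /\ owner n beta = isP1 i).
Proof.
  intros [Ht HW]. unfold winning.
  assert (Hturn : forall x k, fst G (prefix x k) = i <-> turn_name p (pos x k) = isP1 i).
  { intros x k. unfold turn_name. rewrite prefix_word.
    destruct (Ht (pos x k)) as [[E ->]|[E ->]]; rewrite E; destruct i; simpl; split; easy. }
  assert (L : forall x, (exists beta, outcome n (entered p) x beta /\ owner n beta = isP1 i) <->
                   match i with P1 => snd G x | P2 => ~ snd G x end).
  { intros x. assert (HD : snd G x <-> Dm_cond (S n) (opens p) x) by apply HW.
    destruct i; rewrite HD, Dm_cond_outcome; [reflexivity|]. split.
    - intros (b & H & K) (b' & H' & K').
      rewrite (outcome_unique _ _ _ _ _ H H') in K by apply entered_S. simpl in K; congruence.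
    - intros H. destruct (classic (exists g, g <= n /\ opens p g x)) as [(g & Hg & Ho)|N].
      + destruct (dec_inh_nat_subset_has_unique_least_element (fun g => opens p g x))
          as (b & (Hb & Hmin) & _); [intros; apply classic|eauto|].
        exists b. assert (O : outcome n (entered p) x b).
        { apply outcome_opens. split; [|split; auto].
          * specialize (Hmin _ Ho); lia.
          * intros g' Hg' K. specialize (Hmin _ K); lia. }
        split; auto. simpl. apply not_true; eauto.
      + exists (S n). split; [|unfold owner; simpl isP1; apply xorb_nilpotent].
        apply outcome_opens. repeat split; auto. intros g Hg K. apply N; exists g; split; auto; lia. }
  unfold follows. split; intros H x Hx.
  - apply L, H. intros k Hk. rewrite Hx; [now rewrite prefix_word|lia|now apply Hturn].
  - apply L, H. intros k _ Hk. rewrite Hx; [now rewrite prefix_word|now apply Hturn].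
Qed.

(** * Winning positions and good profiles as iterated limits *)

Definition wins_name n p : nat -> nat -> bool := wins n (turn_name p) (entered p).
Definition wins_stage_name n p : nat -> nat -> nat -> bool := wins_stage n (turn_name p) (entered p).

(** A point is read as a profile: [x v] is the move at the node with code [v]. *)
Definition good n p (x : Cantor) : Prop :=
  forall v M, misstep n (turn_name p) (entered p) (wins_name n p) v (x v) M = false.

Lemma good_nonempty n p : exists x, good n p x.
Proof.
  destruct (choice (fun v b => forall M, misstep n (turn_name p) (entered p) (wins_name n p) v b M = false))
    as (x & Hx).
  - intros v. apply good_exists; auto using entered_0, entered_S.
  - exists x; exact Hx.
Qed.

Lemma good_winning n p G x : rep_game (rep_Dm (S n)) p G -> good n p x ->
  winning G (if wins_name n p (S n) 0 then P1 else P2) (fun w => x (enc w)).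
Proof.
  intros HG Hx. rewrite winning_outcome by eauto. intros y Hy.
  apply (good_strategy_wins n (turn_name p) (entered p) (entered_0 p)
           (entered_snoc p) x Hx (S n) y 0); auto.
  - intros k Hk Hi. rewrite Hy; auto. now rewrite enc_word.
  (* The root has level [S n], owned by player 2, so the attacker there is player 1. *)
  - rewrite pos_0. fold (wins_name n p). unfold owner. rewrite xorb_nilpotent.
    now destruct (wins_name n p (S n) 0).
Qed.

(** [r] is the join of the name of the game with a table of values of [wins_stage]. *)
Definition step n (r : B) (zM : nat) : nat :=
  if Nat.even (pi1 zM) then r (pi1 zM)
  else Nat.b2n (forced n (turn_name (left_half r)) (entered (left_half r))
    (fun v => right_half r (npair (pred (pi1 (Nat.div2 (pi1 zM)))) v) =? 1)
    (pi1 (Nat.div2 (pi1 zM))) (pi2 zM) (pi2 (Nat.div2 (pi1 zM)))).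

Definition stage n p i : B := bjoin p (fun z => Nat.b2n (wins_stage_name n p i (pi1 z) (pi2 z))).

Lemma b2n_eqb1 b : (Nat.b2n b =? 1) = b.
Proof. now destruct b. Qed.

Lemma right_stage n p i beta v : (right_half (stage n p i) (npair beta v) =? 1) = wins_stage_name n p i beta v.
Proof. unfold stage. now rewrite right_bjoin, pi1_npair, pi2_npair, b2n_eqb1. Qed.

(** Even entries are copied. At odd ones the limit index serves as cut-off, and by [forced_mono] the
    values converge to the truth of the existential statement defining the next stage. *)
Lemma step_stage n p i : islim (step n (stage n p i)) (stage n p (S i)).
Proof.
  intros z. destruct (Nat.even z) eqn:E.
  - exists 0; intros j _. unfold step. rewrite pi1_npair, E.
    unfold stage, bjoin. now rewrite E.
  - set (y := Nat.div2 z).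
    assert (Hs : stage n p (S i) z = Nat.b2n (wins_stage_name n p (S i) (pi1 y) (pi2 y))).
    { unfold stage, bjoin. now rewrite E. }
    assert (Hj : forall j, step n (stage n p i) (npair z j) =
              Nat.b2n (forced n (turn_name p) (entered p) (wins_stage_name n p i (pred (pi1 y))) (pi1 y) j (pi2 y))).
    { intros j. unfold step. rewrite pi1_npair, pi2_npair, E. fold y.
      assert (Hl : left_half (stage n p i) = p) by apply left_bjoin. rewrite Hl.
      do 2 f_equal. apply functional_extensionality; intro v. apply right_stage. }
    rewrite Hs.
    change (wins_stage_name n p (S i) (pi1 y) (pi2 y)) with (truth (exists M, forced n (turn_name p) (entered p)
      (wins_stage_name n p i (pred (pi1 y))) (pi1 y) M (pi2 y) = true)).
    destruct (classic (exists M, forced n (turn_name p) (entered p) (wins_stage_name n p i (pred (pi1 y))) (pi1 y) M (pi2 y) = true))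
      as [H|H].
    + rewrite (proj2 (truth_iff _) H). destruct H as [M HM]. exists M; intros j Hle.
      rewrite Hj. now rewrite (forced_mono _ _ _ _ _ _ _ _ Hle HM).
    + rewrite (not_true _ (fun K => H (proj1 (truth_iff _) K))). exists 0; intros j _.
      rewrite Hj. destruct (forced _ _ _ _ _ _ _) eqn:K; auto. exfalso; eauto.
Qed.

Lemma stage_0 n p : stage n p 0 = bjoin p (fun _ => 0).
Proof. reflexivity. Qed.

(** A bad move constrains one coordinate of the profile, which in general is no cylinder. So [z]
    also supplies an arbitrary word whose length is the node, and this word extended by the bad bit
    is listed. *)
Definition bad_name n (r : B) (z : nat) : nat :=
  if misstep n (turn_name (left_half r)) (entered (left_half r)) (fun beta v => right_half r (npair beta v) =? 1)
       (len (pi1 z)) (pi1 (pi2 z) =? 1) (pi2 (pi2 z))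
  then S (snoc (pi1 z) (pi1 (pi2 z) =? 1)) else 0.

Definition win_name n (r : B) (M : nat) : nat :=
  Nat.b2n (forced n (turn_name (left_half r)) (entered (left_half r)) (fun v => right_half r (npair n v) =? 1) (S n) M 0).

Lemma PR_step n : PR (step n).
Proof.
  unfold step, forced, backward, table, lookup, rule, owner, turn_name, entered, left_half, right_half, snoc; cbv zeta; pr.
Qed.

Lemma PR_bad_name n : PR (bad_name n).
Proof.
  unfold bad_name, misstep, forced, backward, table, lookup, rule, owner, turn_name, entered, left_half, right_half, snoc; cbv zeta; pr.
Qed.

Lemma PR_win_name n : PR (win_name n).
Proof.
  unfold win_name, forced, backward, table, lookup, rule, owner, turn_name, entered, left_half, right_half, snoc; cbv zeta; pr.
Qed.

Lemma right_stage_wins n p beta : beta <= n ->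
  (fun v => right_half (stage n p n) (npair beta v) =? 1) = wins_name n p beta.
Proof.
  intros H. apply functional_extensionality; intro v. rewrite right_stage.
  unfold wins_stage_name. now rewrite wins_stage_eq by auto using entered_0.
Qed.

Lemma bad_name_closed n p : rep_closed (bad_name n (stage n p n)) (good n p).
Proof.
  intros x.
  assert (E : forall v b M, misstep n (turn_name (left_half (stage n p n))) (entered (left_half (stage n p n)))
             (fun beta v => right_half (stage n p n) (npair beta v) =? 1) v b M =
           misstep n (turn_name p) (entered p) (wins_name n p) v b M).
  { intros v b M. assert (Hl : left_half (stage n p n) = p) by apply left_bjoin. rewrite Hl.
    apply bex_ext. intros i Hi. now rewrite right_stage_wins by lia. }
  split.
  - intros H (z & k & Hz & Hc). unfold bad_name in Hz. rewrite E in Hz.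
    destruct (misstep _ _ _ _ _ _ _) eqn:Hbad in Hz; [|easy].
    injection Hz as <-. apply in_cyl_pos in Hc as (j & Hj).
    assert (Hlen := f_equal len Hj). rewrite len_pos, len_snoc in Hlen. subst j.
    assert (Hx : x (len (pi1 z)) = (pi1 (pi2 z) =? 1)).
    { rewrite <- (bit_pos x (S (len (pi1 z)))), Hj by lia.
      rewrite <- (enc_word (pi1 z)), <- enc_snoc, len_enc, bit_enc, app_nth2, Nat.sub_diag; auto. }
    specialize (H (len (pi1 z)) (pi2 (pi2 z))). rewrite Hx in H. congruence.
  - intros H v M. apply not_true; intros Hb. apply H.
    exists (npair (pos x v) (npair (Nat.b2n (x v)) M)), (pos x (S v)). split.
    + unfold bad_name. repeat rewrite ?pi1_npair, ?pi2_npair. rewrite b2n_eqb1, len_pos, E, Hb.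
      now rewrite pos_S.
    + apply in_cyl_pos; eauto.
Qed.

Lemma PR_stage_0 : PR (fun p => bjoin p (fun _ => 0)).
Proof. unfold bjoin. pr. Qed.

Lemma limn_stage n F : PR F -> exists E, PR E /\
  forall p, limn n (E p) (F (stage n p n)).
Proof.
  intros HF. destruct (PR_limn_iterate (step n) F n (PR_step n) HF) as (E & HE & H).
  exists (fun p => E (bjoin p (fun _ => 0))). split.
  - exact (PR_subst _ _ HE PR_stage_0).
  - intros p. rewrite <- (stage_0 n). apply (H (stage n p)). intros; apply step_stage.
Qed.

Lemma Det_le_CC n : wle (rep_game (rep_Dm (S n))) rep_profile Det (jumpn n rep_closed) rep_cantor CC.
Proof.
  destruct (limn_stage n _ (PR_bad_name n)) as (E & HE & HL).
  destruct (PR_code _ HE) as (h & Hh).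
  destruct (PR_code (fun r x => right_half r x)) as (k & Hk); [unfold right_half; pr|].
  exists h, k. intros D G HG p g Hp _. exists (E p). split; [apply Hh|].
  destruct (HG (E p) (good n p)) as [HD (x & Hx & Hc)].
  - apply jumpn_limn. eexists; split; [apply HL|apply bad_name_closed].
  - apply good_nonempty.
  - split; auto. exists (G (E p)). split.
    { rewrite <- (right_bjoin p (G (E p))) at 2. apply Hk. }
    exists (fun w => x (enc w)). split.
    + intros m. now rewrite enc_word.
    + pose proof (good_winning _ _ _ _ Hp Hc) as Hw. unfold Det. destruct (wins_name n p (S n) 0); auto.
Qed.

Lemma games_determined n p g : rep_game (rep_Dm (S n)) p g -> exists s, Det g s.
Proof.
  intros Hp. destruct (good_nonempty n p) as (x & Hx). eexists.
  pose proof (good_winning _ _ _ _ Hp Hx) as Hw. unfold Det. destruct (wins_name n p (S n) 0); eauto.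
Qed.

(** The sequence given to [LPO] is [1] at the cut-offs at which player 1 forces a win from the root,
    so the answer [true] means that player 2 wins. *)
Lemma Win_le_LPO n : wle (rep_game (rep_Dm (S n))) rep_player Win (jumpn n rep_cantor) rep_bool LPO.
Proof.
  destruct (limn_stage n _ (PR_win_name n)) as (E & HE & HL).
  destruct (PR_code _ HE) as (h & Hh).
  destruct (PR_code (fun r x => if right_half r 0 =? 0 then 1 else 2)) as (k & Hk); [unfold right_half; pr|].
  exists h, k. intros D G HG p g Hp _. exists (E p). split; [apply Hh|].
  set (y := fun M => forced n (turn_name p) (entered p) (wins_name n p n) (S n) M 0).
  destruct (HG (E p) y) as [HD (b & Hb & Hy)].
  - apply jumpn_limn. eexists; split; [apply HL|]. intros M. unfold win_name.
    assert (Hl : left_half (stage n p n) = p) by apply left_bjoin. rewrite Hl.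
    now rewrite right_stage_wins by lia.
  - destruct (classic (forall M, y M = false)) as [H|H].
    + exists true. now split.
    + exists false. now split.
  - split; auto. eexists; split; [apply Hk|].
    exists (if wins_name n p (S n) 0 then P1 else P2). cbn beta. rewrite right_bjoin.
    unfold rep_bool in Hb. rewrite Hb. split.
    + assert (Hu : wins_name n p (S n) 0 = negb b).
      { apply eq_true_iff_eq. unfold wins_name. rewrite wins_iff by auto using entered_0.
        rewrite negb_true_iff. unfold forced_by. cbn [pred]. fold (wins_name n p). unfold LPO in Hy. split.
        - intros [M HM]. apply not_true; intros Ht. apply (proj1 Hy) with (n := M) in Ht. unfold y in Ht. congruence.
        - intros ->. apply NNPP; intros H. enough (false = true) by easy. apply Hy.
          intros M. apply not_true; intros HM. apply H. exists M. exact HM. }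
      rewrite Hu. destruct b; [right|left]; auto.
    + destruct (good_nonempty n p) as (x & Hx). exists (fun w => x (enc w)).
      apply good_winning; auto.
Qed.

(** ** The lower bounds *)

Definition even_prefix (bt : nat -> bool) (l : nat) : nat :=
  rec 0 (fun r a => a + 2 ^ r * S (Nat.b2n (bt (2 * r)))) l.

Lemma even_prefix_pos y l : even_prefix y l = pos (fun r => y (2 * r)) l.
Proof.
  unfold even_prefix. induction l as [|l IH]; [reflexivity|].
  rewrite rec_S, IH, pos_S. unfold snoc. now rewrite len_pos.
Qed.

Lemma even_prefix_ext bt bt' l : (forall i, i < 2 * l -> bt i = bt' i) -> even_prefix bt l = even_prefix bt' l.
Proof.
  unfold even_prefix. induction l as [|l IH]; intros H; [reflexivity|].
  rewrite !rec_S, IH, H by (intros; try apply H; lia). reflexivity.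
Qed.

(** A state packs the number of commitments with the last claim: an index, a value for it, and the
    stage from which that value is claimed to persist. The code [0] is the initial state. *)
Definition phase (s : nat) : nat := pi1 s.
Definition index (s : nat) : nat := pi1 (pi2 s).
Definition val (s : nat) : nat := pi1 (pi2 (pi2 s)).
Definition start (s : nat) : nat := pi2 (pi2 (pi2 s)).
Definition state (i m c j : nat) : nat := npair i (npair m (npair c j)).

Lemma phase_state i m c j : phase (state i m c j) = i.
Proof. unfold phase, state. now rewrite pi1_npair. Qed.
Lemma index_state i m c j : index (state i m c j) = m.
Proof. unfold index, state. now rewrite pi2_npair, pi1_npair. Qed.
Lemma val_state i m c j : val (state i m c j) = c.
Proof. unfold val, state. now rewrite !pi2_npair, pi1_npair. Qed.
Lemma start_state i m c j : start (state i m c j) = j.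
Proof. unfold start, state. now rewrite !pi2_npair. Qed.

(** Enumerates the numbers different from [c], so that every commitment in the game is a legal one. *)
Definition skip (c d : nat) : nat := if d <? c then d else S d.

Lemma skip_neq c d : skip c d <> c.
Proof. unfold skip. destruct (Nat.ltb_spec d c); lia. Qed.

Lemma skip_onto c e : e <> c -> exists d, skip c d = e.
Proof.
  intros H. unfold skip. destruct (Nat.lt_trichotomy e c) as [L|[L|L]]; [|easy|].
  - exists e. destruct (Nat.ltb_spec e c); lia.
  - exists (pred e). destruct (Nat.ltb_spec (pred e) c); lia.
Qed.

Section Challenge_game.

(** [kind] is [false] for closed choice and [true] for [LPO]. *)
Variables (n : nat) (kind : bool).

(** What player 1 claims to occur in the [n]-fold limit: a [1], or a listed word that is a prefix of
    player 2's point. *)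
Definition target_value (bt : nat -> bool) (l : nat) : nat := if kind then 1 else S (even_prefix bt l).

(** A commitment made at round [r = <pad, a>] turns a claim [(m, c, j0)] into a claim about index
    [<m, j0 + d>] and a value different from [c], where [a = <d, d', j0'>]; the very first one
    chooses [m] and a length [l <= r], so the even bits it refers to have been played already.
    The padding lets every [a] be played arbitrarily late. *)
Definition next (bt : nat -> bool) (a s : nat) : nat :=
  if phase s =? 0 then state 1 (pi1 a) (target_value bt (pi1 (pi2 a))) (pi2 (pi2 a))
  else state (S (phase s)) (npair (index s) (start s + pi1 a)) (skip (val s) (pi1 (pi2 a))) (pi2 (pi2 a)).

Definition state_at (bt : nat -> bool) (r : nat) : nat :=
  rec 0 (fun r s => if bt (2 * r + 1) && (phase s <=? n) then next bt (pi2 r) s else s) r.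

Lemma state_at_0 bt : state_at bt 0 = 0.
Proof. reflexivity. Qed.

Lemma state_at_S bt r : state_at bt (S r) =
  if bt (2 * r + 1) && (phase (state_at bt r) <=? n) then next bt (pi2 r) (state_at bt r) else state_at bt r.
Proof. apply rec_S. Qed.

Lemma phase_next bt a s : phase (next bt a s) = S (phase s).
Proof. unfold next. destruct (Nat.eqb_spec (phase s) 0) as [->|]; apply phase_state. Qed.

Lemma next_ext bt bt' r s : (forall i, i < 2 * r -> bt i = bt' i) ->
  next bt (pi2 r) s = next bt' (pi2 r) s.
Proof.
  intros H. unfold next, target_value. rewrite (even_prefix_ext bt bt'); auto.
  intros i Hi. apply H. pose proof (pi_le r). pose proof (pi_le (pi2 r)).
  pose proof (pi_le (pi2 (pi2 r))). lia.
Qed.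

Lemma state_at_ext bt bt' r : (forall i, i < 2 * r -> bt i = bt' i) -> state_at bt r = state_at bt' r.
Proof.
  induction r as [|r IH]; intros H; [reflexivity|].
  rewrite !state_at_S, IH, H, (next_ext bt bt') by (intros; try apply H; lia). reflexivity.
Qed.

Definition state_word (v : nat) : nat := state_at (bit v) (Nat.div2 (len v)).

(** At even positions player 2 plays a bit of [x]; at odd positions a bit says whether to commit,
    and belongs to player 1 iff the number of commitments so far is even. *)
Definition turn_word (v : nat) : bool :=
  if Nat.even (len v) then false else Nat.even (phase (state_word v)).

(** [S n - beta] commitments enter [U_beta]; only for [U_0] is the last claim also compared with the
    name. *)
Definition in_open (p : B) (beta v : nat) : bool :=
  (S n <=? phase (state_word v) + beta) && ((1 <=? beta) || (p (index (state_word v)) =? val (state_word v))).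

Definition challenge_name (p : B) (z : nat) : nat :=
  if Nat.even z then if turn_word (Nat.div2 z) then 1 else 2
  else if in_open p (pi1 (Nat.div2 z)) (pi2 (Nat.div2 z)) then S (pi2 (Nat.div2 z)) else 0.

Lemma PR_challenge_name : PR challenge_name.
Proof.
  unfold challenge_name, in_open, turn_word, state_word, state_at, next, target_value, even_prefix, bit, wtl, state, phase, index, val, start, skip; cbv zeta; pr.
Qed.

Lemma turn_challenge_name p : turn_name (challenge_name p) = turn_word.
Proof.
  apply functional_extensionality; intro v. unfold turn_name, challenge_name.
  rewrite Nat.even_even, Nat.div2_double. now destruct (turn_word v).
Qed.

Definition challenge_game (p : B) : game :=
  (fun w => if turn_word (enc w) then P1 else P2, Dm_cond (S n) (opens (challenge_name p))).

Lemma rep_challenge_game p : rep_game (rep_Dm (S n)) (challenge_name p) (challenge_game p).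
Proof.
  split.
  - intros v. simpl fst. rewrite enc_word. unfold challenge_name.
    rewrite Nat.even_even, Nat.div2_double. destruct (turn_word v); auto.
  - intros x. reflexivity.
Qed.

Lemma state_word_pos y k : state_word (pos y k) = state_at y (Nat.div2 k).
Proof.
  unfold state_word. rewrite len_pos. apply state_at_ext. intros i Hi. apply bit_pos.
  pose proof (Nat.div2_odd k). lia.
Qed.

Lemma opens_challenge_name p beta y : opens (challenge_name p) beta y <->
  exists r, S n <= phase (state_at y r) + beta /\ (1 <= beta \/ p (index (state_at y r)) = val (state_at y r)).
Proof.
  assert (E : forall k, in_open p beta (pos y k) = true <-> S n <= phase (state_at y (Nat.div2 k)) + beta /\
            (1 <= beta \/ p (index (state_at y (Nat.div2 k))) = val (state_at y (Nat.div2 k)))).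
  { intros k. unfold in_open. now rewrite state_word_pos, andb_true_iff, orb_true_iff, !Nat.leb_le, Nat.eqb_eq. }
  assert (N : forall j, challenge_name p (2 * npair beta j + 1) = if in_open p beta j then S j else 0).
  { intros j. unfold challenge_name. rewrite Nat.add_1_r, Nat.even_succ, Nat.odd_even, Nat.div2_succ_double.
    now rewrite pi1_npair, pi2_npair. }
  unfold opens, open_named. split.
  - intros (j & k & H & Hc). rewrite N in H. destruct (in_open p beta j) eqn:C; [|easy].
    injection H as <-. apply in_cyl_pos in Hc as (i & <-). apply E in C. eauto.
  - intros (r & H). exists (pos y (2 * r)), (pos y (2 * r)). split.
    + rewrite N. rewrite (proj2 (E (2 * r))); auto. now rewrite Nat.div2_double.
    + apply in_cyl_pos; eauto.
Qed.

(** * Plays in which one player commits truthfully *)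

Section Play.

Variables (q : nat -> B).
Hypothesis q_lim : forall i, i < n -> islim (q i) (q (S i)).

(** [q k] is the [k]-fold limit of the given name [q 0].  After [i] commitments the last
    committer asserts [claim (n + 1 - i)]. *)
Definition claim (k s : nat) : Prop :=
  match k with
  | 0 => q 0 (index s) = val s
  | S k' => forall j, start s <= j -> q k' (npair (index s) j) = val s
  end.

Definition hit (x : nat -> bool) : Prop :=
  exists m l, q n m = if kind then 1 else S (pos x l).

Lemma claim_sound k s : k <= n -> claim k s -> q k (index s) = val s.
Proof.
  destruct k as [|k]; intros Hk H; [exact H|].
  destruct (q_lim k Hk (index s)) as [i0 Hi]. rewrite <- (Hi (i0 + start s)) by lia. apply H; lia.
Qed.

Lemma claim_complete k m c : k <= n -> q k m = c -> exists j, forall i, claim k (state i m c j).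
Proof.
  destruct k as [|k]; intros Hk H; simpl.
  - exists 0. intros i. now rewrite index_state, val_state.
  - destruct (q_lim k Hk m) as [i0 Hi]. exists i0. intros i j.
    rewrite index_state, val_state, start_state. intros Hj. rewrite Hi; auto.
Qed.

(** If the claimed constancy fails, some later entry has another value, and [claim_complete] makes
    this a true reply. If it holds, no reply is true, because [skip] never returns the claimed
    value. *)
Lemma claim_S y k s : k < n -> phase s <> 0 -> (claim (S k) s <-> ~ exists a, claim k (next y a s)).
Proof.
  intros Hk Hs. unfold next. apply Nat.eqb_neq in Hs. rewrite Hs. split.
  - intros H (a & Ha). apply claim_sound in Ha; [|lia]. rewrite index_state, val_state in Ha.
    rewrite H in Ha by lia. now apply (skip_neq (val s) (pi1 (pi2 a))).
  - intros H j Hj. apply NNPP; intros E. apply skip_onto in E as (d & Hd).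
    destruct (claim_complete k _ _ ltac:(lia) (eq_sym Hd)) as (j' & Hj').
    apply H. exists (npair (j - start s) (npair d j')).
    rewrite !pi2_npair, !pi1_npair. replace (start s + (j - start s)) with j by lia. apply Hj'.
Qed.

Lemma claim_init y s : phase s = 0 ->
  ((exists a, claim n (next y a s)) <-> hit (fun r => y (2 * r))).
Proof.
  intros Hs. unfold next, hit. rewrite Hs. simpl Nat.eqb. cbv iota. unfold target_value. split.
  - intros (a & Ha). apply claim_sound in Ha; [|lia]. rewrite index_state, val_state in Ha.
    exists (pi1 a), (pi1 (pi2 a)). now rewrite <- even_prefix_pos.
  - intros (m & l & H). rewrite <- even_prefix_pos in H.
    destruct (claim_complete n _ _ ltac:(lia) H) as (j & Hj).
    exists (npair m (npair l j)). rewrite !pi2_npair, !pi1_npair. apply Hj.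
Qed.

(** [Z] is the player who commits exactly when the resulting claim is true. In [P1_right] a hit is
    demanded only if nobody ever commits, since player 2 may change his point after a commitment. *)
Variables (y : nat -> bool) (Z : bool).
Hypothesis Z_plays : forall r, Nat.even (phase (state_at y r)) = Z ->
  y (2 * r + 1) = truth (claim (n - phase (state_at y r)) (next y (pi2 r) (state_at y r))).
Hypothesis P2_right : Z = false -> ~ hit (fun r => y (2 * r)).
Hypothesis P1_right : Z = true -> (forall r, y (2 * r + 1) = false) -> hit (fun r => y (2 * r)).

Lemma phase_le r : phase (state_at y r) <= S n.
Proof.
  induction r as [|r IH]; [rewrite state_at_0; unfold phase; rewrite pi1_0; lia|].
  rewrite state_at_S. destruct (y (2 * r + 1)), (Nat.leb_spec (phase (state_at y r)) n); simpl; auto.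
  rewrite phase_next; lia.
Qed.

Lemma phase_mono r r' : r <= r' -> phase (state_at y r) <= phase (state_at y r').
Proof.
  induction 1 as [|r' _ IH]; [lia|]. rewrite state_at_S.
  destruct (_ && _); auto. rewrite phase_next; lia.
Qed.

(** Player 1 makes the odd-numbered commitments. Those of [Z] are true; a reply to one of them is
    false by [claim_S], and an opening claim against [Z] is false because there is no hit. *)
Lemma claim_inv r : phase (state_at y r) <> 0 ->
  (claim (S n - phase (state_at y r)) (state_at y r) <-> Z = Nat.odd (phase (state_at y r))).
Proof.
  induction r as [|r IH]; [rewrite state_at_0; unfold phase; rewrite pi1_0; lia|].
  rewrite state_at_S. destruct (y (2 * r + 1)) eqn:Ey; simpl; [|exact IH].
  destruct (Nat.leb_spec (phase (state_at y r)) n) as [L|L]; [|exact IH].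
  intros _. rewrite phase_next, Nat.odd_succ.
  change (S n - S (phase (state_at y r))) with (n - phase (state_at y r)).
  destruct (Bool.bool_dec (Nat.even (phase (state_at y r))) Z) as [E|E].
  - rewrite (Z_plays r E), truth_iff in Ey. split; auto.
  - split; [|intros ->; congruence]. intros C. exfalso.
    destruct (Nat.eq_dec (phase (state_at y r)) 0) as [E0|E0].
    + rewrite E0 in E, C. simpl in E. assert (HZ : Z = false) by (destruct Z; easy).
      apply (P2_right HZ), (claim_init y (state_at y r) E0). rewrite Nat.sub_0_r in C. eauto.
    + assert (HZ : Z = Nat.odd (phase (state_at y r))).
      { rewrite <- Nat.negb_even. destruct Z, (Nat.even (phase (state_at y r))); simpl; congruence. }
      apply IH in HZ; auto. replace (S n - phase (state_at y r)) with (S (n - phase (state_at y r))) in HZ by lia.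
      apply (claim_S y) in HZ; [eauto|lia|auto].
Qed.

Lemma state_at_stable : exists r0, forall r, r0 <= r -> state_at y r = state_at y r0.
Proof.
  assert (H : exists r0, forall r, r0 <= r -> phase (state_at y r) = phase (state_at y r0)).
  { enough (K : forall f r, S n - phase (state_at y r) <= f -> exists r0, forall r, r0 <= r -> phase (state_at y r) = phase (state_at y r0))
      by exact (K _ 0 (le_n _)).
    induction f as [|f IH]; intros r Hr.
    - exists r. intros r' Hle. pose proof (phase_mono _ _ Hle); pose proof (phase_le r'); lia.
    - destruct (classic (exists r', r <= r' /\ phase (state_at y r') <> phase (state_at y r))) as [(r' & Hle & Hne)|N].
      + apply (IH r'). pose proof (phase_mono _ _ Hle); pose proof (phase_le r'); lia.
      + exists r. intros r' Hle. apply NNPP; eauto. }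
  destruct H as [r0 H]. exists r0. induction 1 as [|r Hr IH]; auto.
  pose proof (H (S r) ltac:(lia)) as E. rewrite state_at_S in *. rewrite IH in *.
  destruct (_ && _); auto. rewrite phase_next in E; lia.
Qed.

(** The final number of commitments decides. If it is below [n + 1], the last one (or, if there is
    none, the silence of player 2) belongs to [Z], who would otherwise have a true commitment left
    to make. If all are made, [claim_inv] says who survives the check against the name. *)
Lemma play_won : exists beta, outcome n (entered (challenge_name (q 0))) y beta /\ owner n beta = Z.
Proof.
  destruct state_at_stable as [r0 H0]. set (f := state_at y r0) in *.
  assert (Hmax : forall r, phase (state_at y r) <= phase f).
  { intros r. destruct (Nat.le_ge_cases r r0) as [L|L]; [now apply phase_mono|now rewrite H0]. }
  assert (Hfull : forall r, S n <= phase (state_at y r) -> state_at y r = f).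
  { intros r Hr. destruct (Nat.le_ge_cases r r0) as [L|L]; [|auto].
    unfold f. clear H0 Hmax f. induction L as [|r' L IH]; auto. rewrite state_at_S, <- IH.
    destruct (Nat.leb_spec (phase (state_at y r)) n); [lia|]. now rewrite andb_false_r. }
  assert (Ho : forall beta, opens (challenge_name (q 0)) beta y <->
            S n <= phase f + beta /\ (1 <= beta \/ q 0 (index f) = val f)).
  { intros beta. rewrite opens_challenge_name. split.
    - intros (r & H1 & H2). destruct beta as [|beta].
      + pose proof (Hfull r ltac:(lia)) as E. rewrite E in H1, H2. auto.
      + pose proof (Hmax r). split; lia.
    - intros H. exists r0; exact H. }
  assert (Hquiet : forall r, r0 <= r -> phase f <= n -> y (2 * r + 1) = false).
  { intros r Hr Hn. pose proof (H0 (S r) ltac:(lia)) as E. rewrite state_at_S, (H0 r Hr) in E.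
    destruct (y (2 * r + 1)); auto. destruct (Nat.leb_spec (phase f) n); [|lia].
    apply (f_equal phase) in E. simpl in E. rewrite phase_next in E. lia. }
  (* A player who owes a commitment and has a true one available would have made it. *)
  assert (Hdone : phase f <= n -> Nat.even (phase f) = Z -> ~ exists a, claim (n - phase f) (next y a f)).
  { intros Hn HZ (a & Ha).
    assert (Hr : r0 <= npair r0 a) by (pose proof (npair_ge r0 a); lia).
    pose proof (Hquiet _ Hr Hn) as Q. rewrite Z_plays in Q by (rewrite H0; auto).
    rewrite (H0 _ Hr), pi2_npair in Q. rewrite (proj2 (truth_iff _) Ha) in Q. easy. }
  assert (Hown : forall i, i <= S n -> owner n (S n - i) = Nat.odd i).
  { intros i Hi. unfold owner. rewrite Nat.odd_sub by auto.
    now destruct (Nat.odd (S n)), (Nat.odd i). }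
  pose proof (claim_inv r0) as Hinv. fold f in Hinv.
  assert (Hle : phase f <= S n) by apply phase_le.
  destruct (Nat.eq_dec (phase f) (S n)) as [Hi|Hi].
  - rewrite Hi in *. replace (S n - S n) with 0 in Hinv by lia. specialize (Hinv ltac:(lia)).
    simpl claim in Hinv.
    destruct (classic (q 0 (index f) = val f)) as [C|C].
    + exists 0. rewrite outcome_opens, Ho. repeat split; auto; try lia.
      transitivity (Nat.odd (S n)); [reflexivity|]. symmetry. tauto.
    (* A false last claim does not enter [U_0]; the least index is then [1], owned by the opponent
       of its author. *)
    + exists 1. rewrite outcome_opens. repeat split; try lia.
      * right. apply Ho. lia.
      * intros g Hg K. replace g with 0 in K by lia. apply Ho in K. lia.
      * unfold owner. destruct Z, (Nat.odd (S n)); simpl; try reflexivity; exfalso; tauto.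
  - assert (HZ : Z = Nat.odd (phase f)).
    { apply NNPP; intros E.
      assert (E' : Nat.even (phase f) = Z).
      { rewrite <- Nat.negb_odd. destruct Z, (Nat.odd (phase f)); simpl; congruence. }
      apply Hdone; auto; [lia|].
      destruct (Nat.eq_dec (phase f) 0) as [E0|E0].
      - rewrite E0, Nat.sub_0_r. apply claim_init; auto. apply P1_right.
        + rewrite <- E', E0; reflexivity.
        + intros r. apply not_true; intros K. pose proof (Hmax (S r)) as M. pose proof (Hmax r).
          rewrite state_at_S, K in M. destruct (Nat.leb_spec (phase (state_at y r)) n); [|lia].
          simpl in M. rewrite phase_next in M. lia.
      - apply NNPP; intros K. apply E, Hinv; auto.
        replace (S n - phase f) with (S (n - phase f)) by lia. apply claim_S with y; auto; lia. }
    exists (S n - phase f). split; [|rewrite Hown; auto; lia].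
    rewrite outcome_opens. split; [lia|split].
    + destruct (Nat.eq_dec (phase f) 0) as [E0|E0]; [left; lia|]. right. apply Ho. lia.
    + intros g Hg K. apply Ho in K. lia.
Qed.

End Play.

(** Commit as soon as the resulting claim is true. *)
Definition sigma (q : nat -> B) (v : nat) : bool :=
  truth (claim q (n - phase (state_word v)) (next (bit v) (pi2 (Nat.div2 (len v))) (state_word v))).

Lemma sigma_pos q y r : sigma q (pos y (2 * r + 1)) =
  truth (claim q (n - phase (state_at y r)) (next y (pi2 r) (state_at y r))).
Proof.
  unfold sigma. rewrite state_word_pos, len_pos.
  replace (Nat.div2 (2 * r + 1)) with r by (now rewrite Nat.add_1_r, Nat.div2_succ_double).
  rewrite (next_ext _ y); auto. intros i Hi. apply bit_pos; lia.
Qed.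

Lemma turn_word_even y r : turn_word (pos y (2 * r)) = false.
Proof. unfold turn_word. now rewrite len_pos, Nat.even_even. Qed.

Lemma turn_word_odd y r : turn_word (pos y (2 * r + 1)) = Nat.even (phase (state_at y r)).
Proof.
  unfold turn_word. rewrite state_word_pos, len_pos.
  now rewrite Nat.add_1_r, Nat.even_succ, Nat.odd_even, Nat.div2_succ_double.
Qed.

Definition walk (f : nat -> bool) (k : nat) : nat := rec 0 (fun _ v => snoc v (f v)) k.

Lemma pos_walk f k : pos (fun i => f (walk f i)) k = walk f k.
Proof. induction k as [|k IH]; [reflexivity|]. rewrite pos_S, IH. reflexivity. Qed.

(** Position after [k] rounds if player 1 never commits and player 2 follows [s]. *)
Definition wait (s : nat -> bool) (k : nat) : nat :=
  rec 0 (fun _ v => snoc (snoc v (s v)) false) k.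

Lemma even_or_odd j : exists r, j = 2 * r \/ j = 2 * r + 1.
Proof. exists (Nat.div2 j). pose proof (Nat.div2_odd j). destruct (Nat.odd j); simpl in *; lia. Qed.

Variable (q : nat -> B).
Hypothesis q_lim : forall i, i < n -> islim (q i) (q (S i)).

(** Player 2 can play any [x] against [s]; were it not hit, committing by [sigma] would make him win
    by [play_won]. *)
Lemma P1_winning_hit s x : winning (challenge_game (q 0)) P1 s -> hit q x.
Proof.
  intros H. rewrite winning_outcome in H by apply rep_challenge_game. rewrite turn_challenge_name in H.
  apply NNPP; intros N.
  set (f := fun v => if Nat.even (len v) then x (Nat.div2 (len v))
              else if turn_word v then s (word_of_nat v) else sigma q v).
  set (y := fun i => f (walk f i)).
  assert (Hy : forall k, y k = f (pos y k)) by (intros; unfold y at 2; now rewrite pos_walk).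
  destruct (H y) as (b & Hb & Ob).
  { intros j _ Hj. rewrite Hy. unfold f. destruct (even_or_odd j) as (r & [-> | ->]).
    - now rewrite turn_word_even in Hj.
    - rewrite Hj, len_pos, Nat.add_1_r, Nat.even_succ, Nat.odd_even. reflexivity. }
  destruct (play_won q q_lim y false) as (b' & Hb' & Ob').
  - intros r Hr. rewrite Hy. unfold f. rewrite len_pos, turn_word_odd, Hr.
    rewrite Nat.add_1_r at 1. rewrite Nat.even_succ, Nat.odd_even. apply sigma_pos.
  - intros _. replace (fun r => y (2 * r)) with x; auto.
    apply functional_extensionality; intro r. rewrite Hy. unfold f.
    now rewrite len_pos, Nat.even_even, Nat.div2_double.
  - easy.
  - rewrite (outcome_unique _ _ _ _ _ Hb Hb') in Ob by apply entered_S. simpl in Ob. congruence.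
Qed.

(** The point is the one that [s] plays while player 1 stays silent. Were it hit, player 1 would
    defeat [s] by committing with [sigma]. *)
Lemma P2_winning_not_hit s : winning (challenge_game (q 0)) P2 s ->
  ~ hit q (fun k => s (word_of_nat (wait (fun v => s (word_of_nat v)) k))).
Proof.
  intros H HT. rewrite winning_outcome in H by apply rep_challenge_game. rewrite turn_challenge_name in H.
  set (s' := fun v => s (word_of_nat v)) in *.
  set (f := fun v => if turn_word v then sigma q v else s' v).
  set (y := fun i => f (walk f i)).
  assert (Hy : forall k, y k = f (pos y k)) by (intros; unfold y at 2; now rewrite pos_walk).
  destruct (H y) as (b & Hb & Ob).
  { intros j _ Hj. rewrite Hy. unfold f. now rewrite Hj. }
  destruct (play_won q q_lim y true) as (b' & Hb' & Ob').
  - intros r Hr. rewrite Hy. unfold f. rewrite turn_word_odd, Hr. apply sigma_pos.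
  - easy.
  - intros _ Hq. replace (fun r => y (2 * r)) with (fun k => s' (wait s' k)); auto.
    assert (E : forall r, pos y (2 * r) = wait s' r).
    { induction r as [|r IH]; [reflexivity|].
      replace (2 * S r) with (S (S (2 * r))) by lia. rewrite !pos_S.
      pose proof (Hq r) as Q. rewrite Nat.add_1_r in Q. rewrite Q.
      rewrite Hy. unfold f. rewrite turn_word_even, IH. reflexivity. }
    apply functional_extensionality; intro r. rewrite Hy. unfold f. now rewrite turn_word_even, E.
  - rewrite (outcome_unique _ _ _ _ _ Hb Hb') in Ob by apply entered_S. simpl in Ob. congruence.
Qed.

End Challenge_game.

(** * The reductions from closed choice and [LPO] *)

Lemma limn_chain n p r : limn n p r ->
  exists q : nat -> B, q 0 = p /\ q n = r /\ forall i, i < n -> islim (q i) (q (S i)).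
Proof.
  revert p; induction n as [|n IH]; intros p H.
  - exists (fun _ => p); repeat split; auto; lia.
  - destruct H as (p' & H & K). destruct (IH p' K) as (q & <- & Hr & Hq).
    exists (fun i => match i with 0 => p | S j => q j end). repeat split; auto.
    intros [|i] Hi; auto. apply Hq; lia.
Qed.

(** A point of the nonempty set is not hit, so player 1 cannot be the winner; the winning strategy
    is player 2's, and its play against silence yields a point of the set. *)
Lemma CC_le_Det n : wle (jumpn n rep_closed) rep_cantor CC (rep_game (rep_Dm (S n))) rep_profile Det.
Proof.
  destruct (PR_code _ (PR_challenge_name n false)) as (h & Hh).
  destruct (PR_code (fun r x => right_half r (wait (fun v => right_half r v =? 1) x))) as (k & Hk);
    [unfold right_half, wait, snoc; pr|].
  exists h, k. intros D F HF p A Hp [a Ha].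
  apply jumpn_limn in Hp as (r & Hl & HA). apply limn_chain in Hl as (q & <- & <- & Hq).
  pose proof (rep_challenge_game n false (q 0)) as Hg.
  destruct (HF _ _ Hg (games_determined _ _ _ Hg)) as [HD (s & Hs & Hw)].
  exists (challenge_name n false (q 0)). split; [apply Hh|]. split; auto. eexists; split; [apply Hk|].
  assert (HT : forall x, A x <-> ~ hit n false q x).
  { intros x. rewrite (HA x). apply not_iff_compat. unfold hit, open_named. split.
    - intros (m & c & Hm & Hc). apply in_cyl_pos in Hc as (l & <-). eauto.
    - intros (m & l & Hm). exists m, (pos x l). split; auto. apply in_cyl_pos; eauto. }
  exists (fun k => s (word_of_nat (wait (fun v => s (word_of_nat v)) k))). split.
  - intros m. rewrite right_bjoin.
    replace (fun v => F (challenge_name n false (q 0)) v =? 1) with (fun v => s (word_of_nat v)); [apply Hs|].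
    apply functional_extensionality; intro v. now rewrite Hs, b2n_eqb1.
  - apply HT. destruct Hw as [Hw|Hw].
    + exfalso. apply HT in Ha. eauto using P1_winning_hit.
    + now apply P2_winning_not_hit.
Qed.

(** With [kind = true] a hit is a [1] in the limit sequence, whatever player 2 plays; so player 2
    wins exactly for the zero sequence. *)
Lemma LPO_le_Win n : wle (jumpn n rep_cantor) rep_bool LPO (rep_game (rep_Dm (S n))) rep_player Win.
Proof.
  destruct (PR_code _ (PR_challenge_name n true)) as (h & Hh).
  destruct (PR_code (fun r x => if right_half r 0 =? 1 then 0 else 1)) as (k & Hk); [unfold right_half; pr|].
  exists h, k. intros D F HF p x Hp _.
  apply jumpn_limn in Hp as (r & Hl & Hx). apply limn_chain in Hl as (q & <- & <- & Hq).
  pose proof (rep_challenge_game n true (q 0)) as Hg.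
  destruct (HF _ _ Hg) as [HD (i & Hi & s & Hs)].
  { destruct (games_determined _ _ _ Hg) as (s & [Hs|Hs]); eexists; eexists; eauto. }
  exists (challenge_name n true (q 0)). split; [apply Hh|]. split; auto. eexists; split; [apply Hk|].
  exists (negb (isP1 i)). split.
  - unfold rep_bool. rewrite right_bjoin. destruct Hi as [[-> ->]|[-> ->]]; reflexivity.
  - assert (HT : forall z, hit n true q z <-> exists m, x m = true).
    { intros z. unfold hit. split.
      - intros (m & _ & Hm). exists m. rewrite Hx in Hm. now destruct (x m).
      - intros [m Hm]. exists m, 0. now rewrite Hx, Hm. }
    unfold LPO. destruct i; simpl.
    + apply (P1_winning_hit _ _ q Hq _ x), HT in Hs as [m Hm]. split; [easy|]. intros K. congruence.
    + apply (P2_winning_not_hit _ _ q Hq) in Hs. split; auto. intros _ m. apply not_true; intros K.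
      apply Hs, HT; eauto.
Qed.

Theorem theorem15 : forall n : nat,
  wequiv (rep_game (rep_Dm (S n))) rep_profile Det
         (jumpn n rep_closed) rep_cantor CC
  /\
  wequiv (rep_game (rep_Dm (S n))) rep_player Win
         (jumpn n rep_cantor) rep_bool LPO.
Proof.
  intros n. repeat split.
  - apply Det_le_CC.
  - apply CC_le_Det.
  - apply Win_le_LPO.
  - apply LPO_le_Win.
Qed.
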